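(* Let $\Gamma$ and $G$ be finite connected graphs, let $\tau$ be a free involution on $\Gamma$, and assume that $G$ is not a single point and is not homeomorphic to a circle or to an interval. Then the Borsuk-Ulam property (with respect to $\tau$) fails for all homotopy classes in $[\Gamma,G]$; i.e., for every $\alpha\in[\Gamma,G]$ there is a representative $f\in\alpha$ satisfying $f(x)\neq f(\tau\cdot x)$ for all $x\in\Gamma$.
   Context: Graphs are regarded as topological spaces (finite 1-dimensional CW complexes). Spaces come equipped with base points, maps are continuous and preserve base points, and $[\Gamma,G]$ denotes the set of based homotopy classes of based maps $\Gamma\to G$. The involution $\tau\colon\Gamma\to\Gamma$ is a continuous map with $\tau\circ\tau=\mathrm{id}$ and without fixed points; it is not required to preserve the base point. The Borsuk-Ulam property holds for a class $\alpha\in[\Gamma,G]$ (with respect to $\tau$) if for every representative $f\in\alpha$ there is a point $x\in\Gamma$ with $f(x)=f(\tau\cdot x)$; otherwise it fails for $\alpha$. *)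

(* Defs.v *)
From HB Require Import structures.
From mathcomp Require Import all_boot all_order all_algebra.
From mathcomp Require Import boolp classical_sets functions set_interval reals.
From mathcomp Require Import topology.

Set Implicit Arguments.
Unset Strict Implicit.
Unset Printing Implicit Defensive.

Import Order.TTheory GRing.Theory Num.Theory.
Import numFieldTopology.Exports.

Local Open Scope classical_set_scope.
Local Open Scope ring_scope.

(* Base points are the canonical points of [ptopologicalType]s. *)

(* [set_type A] carries the subspace topology (unlike [subspace A], whose
   carrier is the whole ambient type). *)
Definition unit_interval (R : realType) : topologicalType :=
  set_type (`[0, 1]%classic : set R).

Definition circle (R : realType) : topologicalType :=
  set_type [set z : R * R | z.1 ^+ 2 + z.2 ^+ 2 = 1].

Definition homeomorphic (X Y : topologicalType) : Prop :=
  exists (f : X -> Y) (g : Y -> X),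
    [/\ continuous f, continuous g, cancel f g & cancel g f].

(* A finite CW structure of dimension at most 1 on X: [v] lists the 0-cells and
   [c e] is the characteristic map of the 1-cell [e].  Since V is discrete,
   [cw_topology] says that X carries the quotient topology of the disjoint union
   of V and of E copies of [0, 1]; in particular each [c e] is continuous.
   Loops and multiple edges are allowed. *)
Record graph_structure (R : realType) (X : topologicalType) (V E : finType)
    (v : V -> X) (c : E -> unit_interval R -> X) : Prop := GraphStructure {
  cw_vertex_inj : injective v;
  cw_boundary : forall e t, set_val t = 0 \/ set_val t = 1 ->
    range v (c e t);
  cw_interior : forall e t, 0 < set_val t < 1 -> ~ range v (c e t);
  cw_interior_inj : forall e1 e2 t1 t2,
    0 < set_val t1 < 1 -> 0 < set_val t2 < 1 ->
    c e1 t1 = c e2 t2 -> e1 = e2 /\ t1 = t2;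
  cw_cover : forall x, range v x \/ exists e, range (c e) x;
  cw_topology : forall U : set X,
    open U <-> forall e, open (c e @^-1` U)
}.

Definition finite_graph (R : realType) (X : topologicalType) : Prop :=
  exists (V E : finType) (v : V -> X) (c : E -> unit_interval R -> X),
    graph_structure v c.

Record free_involution (X : topologicalType) (tau : X -> X) : Prop :=
  FreeInvolution {
  finv_continuous : continuous tau;
  finv_involutive : involutive tau;
  finv_free : forall x, tau x <> x
}.

Definition based_map (X Y : ptopologicalType) : set (X -> Y) :=
  [set f | continuous f /\ f point = point].

Definition based_homotopic (R : realType) (X Y : ptopologicalType)
    (f g : X -> Y) : Prop :=
  exists H : X * unit_interval R -> Y,
    [/\ continuous H,
        forall x t, set_val t = 0 -> H (x, t) = f x,
        forall x t, set_val t = 1 -> H (x, t) = g x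
      & forall t, H (point, t) = point].

(* The set [X, Y], its elements being sets of maps. *)
Definition homotopy_classes (R : realType) (X Y : ptopologicalType) :
    set (set (X -> Y)) :=
  [set alpha | exists2 f, based_map f &
    alpha = [set g | based_map g /\ based_homotopic R f g]].

Arguments homotopy_classes R X Y : clear implicits.

Definition borsuk_ulam_property (X Y : ptopologicalType) (tau : X -> X)
    (alpha : set (X -> Y)) : Prop :=
  forall f, alpha f -> exists x, f x = f (tau x).

(* Main.v *)
(* Idea. Choosing a cell structure of G with as few edges as possible, one finds
   a vertex of degree at least 3, since a vertex of degree 2 joining two edges
   could be erased and otherwise G is a point, an interval or a circle. On a
   subdivision S of G which is a simple graph, two tokens on distinct vertices
   can perform any prescribed pair of walks, up to homotopy and without ever
   meeting: whenever one token has to pass the other, both travel to a vertex of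
   degree at least 3, where one of them waits on a third branch.

   On the other side, Gamma has a tau-invariant cell structure, and tau fixes no
   edge because an involution of an open interval has a fixed point. After
   dragging the images of u and tau u to distinct vertices of S for every vertex
   u of Gamma, the paths f(e) and f(tau e) are, up to homotopy, a pair of walks
   on S, and can be replaced by paths that never meet. *)

Require Import Defs.
From HB Require Import structures.
From mathcomp Require Import all_boot all_order all_algebra.
From mathcomp Require Import boolp classical_sets functions set_interval reals.
From mathcomp Require Import topology normedtype.
From mathcomp Require realfun.
From mathcomp Require Import ring lra.

Set Implicit Arguments.
Unset Strict Implicit.
Unset Printing Implicit Defensive.

Import Order.TTheory GRing.Theory Num.Theory.
Import numFieldTopology.Exports numFieldNormedType.Exports.

Local Open Scope classical_set_scope.
Local Open Scope ring_scope.

(** * Continuity and connectedness *)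

(** The invariant structure on Gamma is built so that [tau] exchanges the points [c (e, b) t] and
    [c (e, ~~ b) t], with the same parameter. The deformed map therefore only has to separate the
    two paths of such a pair at equal times; different pairs impose nothing on each other. This
    leaves a question about two paths in G between vertices of S, with distinct starting points and
    distinct end points.

    The homotopy must also fix the base point. Hence the base point of Gamma is made a vertex of the
    invariant structure, the base point of G is made a vertex of S, and the distinct target vertices
    are assigned so that the base vertex need not move.

    A walk is a list of vertices, and a list determines a path only when there are no multiple
    edges; this is why every edge of G is cut into three. Continuity of maps out of Gamma times an
    interval, and of maps into G, rests on compactness: finite unions of compact images are closed
    in a Hausdorff space, and finitely many coordinates that separate the points of a compact space
    determine its topology. *)

Section ContinuousReal.
Variables (R : realType) (T : topologicalType).
Implicit Types f g : T -> R.

Lemma cts_add f g : continuous f -> continuous g ->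
  continuous (fun x => f x + g x).
Proof. by move=> cf cg x; apply: (@continuousD R R T f g x); [exact: cf|exact: cg]. Qed.

Lemma cts_opp f : continuous f -> continuous (fun x => - f x).
Proof. by move=> cf x; apply: (@continuousN R R T f x); exact: cf. Qed.

Lemma cts_mul f g : continuous f -> continuous g ->
  continuous (fun x => f x * g x).
Proof. by move=> cf cg x; apply: (@continuousM R T f g x); [exact: cf|exact: cg]. Qed.

Lemma cts_min f g : continuous f -> continuous g ->
  continuous (fun x => Num.min (f x) (g x)).
Proof. by move=> cf cg x; apply: (@continuous_min R T f g x); [exact: cf|exact: cg]. Qed.

Lemma cts_max f g : continuous f -> continuous g ->
  continuous (fun x => Num.max (f x) (g x)).
Proof. by move=> cf cg x; apply: (@continuous_max R T f g x); [exact: cf|exact: cg]. Qed.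

Lemma cts_norm f : continuous f -> continuous (fun x => `|f x|).
Proof.
by move=> cf x; apply: continuous_comp; [exact: cf|exact: (@norm_continuous R R)].
Qed.

Lemma cts_sum (I : finType) (P : pred I) (F : I -> T -> R) :
  (forall i, continuous (F i)) -> continuous (fun x => \sum_(i | P i) F i x).
Proof.
move=> cF; rewrite /index_enum; elim: (Finite.enum I) => [|i s IHs].
  under eq_fun do rewrite big_nil; exact: cst_continuous.
under eq_fun do rewrite big_cons.
by case: (P i) => //; apply: cts_add.
Qed.

End ContinuousReal.

Section ContinuousGeneral.
Variables (R : realType).

Lemma cts_id (T : topologicalType) : continuous (fun x : T => x).
Proof. by move=> x; exact: cvg_id. Qed.

Lemma cts_comp (X Y Z : topologicalType) (f : X -> Y) (g : Y -> Z) :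
  continuous g -> continuous f -> continuous (fun x => g (f x)).
Proof. by move=> cg cf x; apply: continuous_comp; [exact: cf|exact: cg]. Qed.

Lemma cts_pair (X Y Z : topologicalType) (f : X -> Y) (g : X -> Z) :
  continuous f -> continuous g -> continuous (fun x => (f x, g x)).
Proof. by move=> cf cg x; apply: cvg_pair; [exact: cf|exact: cg]. Qed.

Lemma cts_fst (Y Z : topologicalType) : continuous (fun x : Y * Z => x.1).
Proof. by move=> x; apply: cvg_fst. Qed.

Lemma cts_snd (Y Z : topologicalType) : continuous (fun x : Y * Z => x.2).
Proof. by move=> x; apply: cvg_snd. Qed.

Lemma closed_le_cts (T : topologicalType) (f g : T -> R) :
  continuous f -> continuous g -> closed [set x | f x <= g x].
Proof.
move=> cf cg.
have -> : [set x | f x <= g x] = (fun x => f x - g x) @^-1` [set y | y <= 0].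
  by apply/seteqP; split=> x /=; rewrite subr_le0.
apply: (continuous_closedP _).1; last exact: closed_le.
by apply: cts_add => //; exact: cts_opp.
Qed.

Lemma open_lt_cts (T : topologicalType) (f g : T -> R) :
  continuous f -> continuous g -> open [set x | f x < g x].
Proof.
move=> cf cg.
have -> : [set x | f x < g x] = ~` [set x | g x <= f x].
  by apply/seteqP; split=> x /=; [rewrite ltNge => /negP|move/negP; rewrite -ltNge].
by apply: closed_openC; exact: closed_le_cts.
Qed.

Lemma cts_if (T Z : topologicalType) (h : T -> R) (a : R) (f g : T -> Z) :
  continuous h -> continuous f -> continuous g ->
  (forall x, h x = a -> f x = g x) ->
  continuous (fun x => if h x <= a then f x else g x).
Proof.
move=> ch cf cg fg; apply/continuous_closedP => C cC.
have -> : (fun x => if h x <= a then f x else g x) @^-1` C =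
   ([set x | h x <= a] `&` f @^-1` C) `|` ([set x | a <= h x] `&` g @^-1` C).
  apply/seteqP; split=> x /=.
    by case: (leP (h x) a) => [ha Cf|/ltW ha Cg]; [left|right].
  case=> -[hx Cx]; first by rewrite hx.
  by case: (leP (h x) a) => // hx'; rewrite fg //; apply/le_anti; rewrite hx hx'.
apply: closedU; apply: closedI.
- by apply: closed_le_cts => //; exact: cst_continuous.
- by move/continuous_closedP: cf; apply.
- by apply: closed_le_cts => //; exact: cst_continuous.
- by move/continuous_closedP: cg; apply.
Qed.

Lemma hausdorff_by_functions (T : topologicalType) :
  (forall x y : T, x <> y -> exists2 g : T -> R, continuous g & g x <> g y) ->
  hausdorff_space T.
Proof.
move=> sep x y xy; apply: contrapT => /sep[g cg] /eqP gxy.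
have : hausdorff_space R by exact: Rhausdorff.
move=> /(_ (g x) (g y)) h; case/eqP: gxy; apply: h => A B Ax By.
have [z [Az Bz]] := xy (g @^-1` A) (g @^-1` B) (cg x _ Ax) (cg y _ By).
by exists (g z).
Qed.

Lemma hausdorff_pair (X Y : topologicalType) :
  hausdorff_space X -> hausdorff_space Y -> hausdorff_space (X * Y)%type.
Proof.
move=> hX hY [x y] [x' y'] cl; congr pair; [apply: hX|apply: hY] => A B Ax By.
  have [|| z [Az Bz]] := cl (fst @^-1` A) (fst @^-1` B); first exact: cvg_fst.
    exact: cvg_fst.
  by exists z.1.
have [|| z [Az Bz]] := cl (snd @^-1` A) (snd @^-1` B); first exact: cvg_snd.
  exact: cvg_snd.
by exists z.2.
Qed.

(** [P] and its negation are both relatively open in a connected set. The form with an arbitrary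
    proposition serves wherever a discrete fact (an edge, a sign, the existence of a walk) depends
    on a real parameter. *)
Lemma connected_locally_constant (T : topologicalType) (A : set T) (P : T -> Prop) :
  connected A ->
  (forall x, A x -> \forall y \near x, A y -> (P x <-> P y)) ->
  forall x y, A x -> A y -> P x -> P y.
Proof.
move=> cA lc x y Ax Ay Px.
pose U (Q : T -> Prop) := interior [set y | A y -> Q y].
have oU Q : open (U Q) by exact: open_interior.
have BP : A `&` P = A; last by move: Ay; rewrite -BP => -[].
apply: cA; first by exists x.
  exists (U P); first exact: oU.
  apply/seteqP; split=> z [Az] /=.
    by move=> Pz; split=> //; near=> w => Aw; apply/(near (lc z Az) w).
  by move=> /nbhs_singleton /(_ Az).
exists (~` U (fun z => ~ P z)); first exact/open_closedC/oU.
apply/seteqP; split=> z [Az] /=.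
  by move=> Pz; split=> // /nbhs_singleton /(_ Az).
move=> nU; split=> //; apply: contrapT => nPz; apply: nU.
by near=> w => Aw Pw; apply: nPz; apply/(near (lc z Az) w).
Unshelve. all: by end_near. Qed.

Lemma connected_two_valued (T : topologicalType) (g : T -> R) (x y : T) :
  connected [set: T] -> continuous g -> (forall z, g z = 0 \/ g z = 1) ->
  g x = g y.
Proof.
move=> cT cg g01.
have one a b : g a = 1 -> g b = 1.
  apply: (@connected_locally_constant _ _ (fun z => g z = 1) cT) => // z _.
  case: (g01 z) => gz.
    have : (\forall w \near z, g w < 1).
      apply: open_nbhs_nbhs; split; last by rewrite /= gz ltr01.
      by apply: open_lt_cts => //; exact: cst_continuous.
    by apply: filterS => w w1 _; rewrite gz; split=> [/eqP|gw];
      [rewrite eq_sym oner_eq0|move: w1; rewrite gw ltxx].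
  have : (\forall w \near z, 0 < g w).
    apply: open_nbhs_nbhs; split; last by rewrite /= gz ltr01.
    by apply: open_lt_cts => //; exact: cst_continuous.
  by apply: filterS => w w0 _; split=> // _; case: (g01 w) => // gw; move: w0; rewrite gw ltxx.
case: (g01 x) (g01 y) => gx [] gy; rewrite ?gx ?gy //; last first.
  by rewrite -gy (one x y).
by rewrite -gx (one y x).
Qed.

Lemma compact_bijection_homeomorphism (X Y : topologicalType) (f : X -> Y) :
  compact [set: X] -> hausdorff_space Y -> continuous f -> injective f ->
  (forall y, exists x, f x = y) -> homeomorphic X Y.
Proof.
move=> cX hY cf fi fs; pose g y := sval (cid (fs y)).
have fK y : f (g y) = y by rewrite /g; case: cid.
have gK x : g (f x) = x by apply: fi.
exists f, g; split=> //; apply/continuous_closedP => C cC.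
have -> : g @^-1` C = f @` C.
  apply/seteqP; split=> y /=; first by move=> Cy; exists (g y).
  by move=> [x Cx <-]; rewrite gK.
apply: compact_closed => //; apply: continuous_compact.
  exact: continuous_subspaceT.
by apply: (subclosed_compact cC cX).
Qed.

Lemma homeomorphic_sym (X Y : topologicalType) :
  homeomorphic X Y -> homeomorphic Y X.
Proof. by move=> [f [g [? ? ? ?]]]; exists g, f. Qed.

End ContinuousGeneral.

Ltac cts := cbv beta; lazymatch goal with
  | |- forall x, @continuous_at _ _ x (fun y => (_ + _)%R) =>
      apply: cts_add; cts
  | |- forall x, @continuous_at _ _ x (fun y => (- _)%R) => apply: cts_opp; cts
  | |- forall x, @continuous_at _ _ x -%R => exact: cts_opp (@cts_id _)
  | |- forall x, @continuous_at _ _ x ( *%R _) =>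
      exact: cts_mul (@cst_continuous _ _ _) (@cts_id _)
  | |- forall x, @continuous_at _ _ x (+%R _) =>
      exact: cts_add (@cst_continuous _ _ _) (@cts_id _)
  | |- forall x, @continuous_at _ _ x (fun y => (_ * _)%R) =>
      apply: cts_mul; cts
  | |- forall x, @continuous_at _ _ x (fun y => Num.min _ _) =>
      apply: cts_min; cts
  | |- forall x, @continuous_at _ _ x (fun y => Num.max _ _) =>
      apply: cts_max; cts
  | |- forall x, @continuous_at _ _ x (fun y => `|_|) => apply: cts_norm; cts
  | |- forall x, @continuous_at _ _ x (fun y => (_, _)) => apply: cts_pair; cts
  | |- forall x, @continuous_at _ _ x (fun y => y) => exact: cts_id
  | |- forall x, @continuous_at _ _ x (fun y => _.1) =>
      first [exact: cts_fst | idtac]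
  | |- forall x, @continuous_at _ _ x (fun y => _.2) =>
      first [exact: cts_snd | idtac]
  | |- _ => first [assumption | exact: cst_continuous | exact: cts_fst
      | exact: cts_snd | idtac]
  end.

Section Clamp.
Variable R : realType.

(** The retraction of the line onto [0, 1]. It lets paths and homotopies be total functions on the
    line, so that continuity is never relative to a subset. *)
Definition clamp (t : R) : R := Num.max 0 (Num.min t 1).

Lemma clamp_cts (T : topologicalType) (f : T -> R) :
  continuous f -> continuous (fun x => clamp (f x)).
Proof. by move=> cf; rewrite /clamp; cts. Qed.

Lemma clamp_itv t : 0 <= clamp t <= 1.
Proof. by rewrite /clamp le_max lexx /= ge_max ler01 ge_min lexx orbT. Qed.

Lemma clamp_id t : 0 <= t <= 1 -> clamp t = t.
Proof. by move=> /andP[t0 t1]; rewrite /clamp (min_idPl t1) (max_idPr t0). Qed.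

Lemma clamp0 : clamp 0 = 0. Proof. by rewrite clamp_id // lexx ler01. Qed.
Lemma clamp1 : clamp 1 = 1. Proof. by rewrite clamp_id // lexx ler01. Qed.

Lemma clamp_unit_proof t : clamp t \in (`[0, 1]%classic : set R).
Proof. by rewrite inE /= in_itv /= clamp_itv. Qed.

Definition clampI (t : R) : unit_interval R := SigSub (clamp_unit_proof t).

Lemma clampIE t : set_val (clampI t) = clamp t. Proof. by []. Qed.

Lemma unit_itv (t : unit_interval R) : 0 <= set_val t <= 1.
Proof. by have := valP t; rewrite inE /= in_itv. Qed.

Lemma clampIK (t : unit_interval R) : clampI (set_val t) = t.
Proof. by apply: val_inj; rewrite /= clamp_id // unit_itv. Qed.

Lemma set_val_cts : continuous (set_val : unit_interval R -> R).
Proof. exact: initial_continuous. Qed.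

Lemma clampI_cts : continuous clampI.
Proof.
apply: continuous_comp_initial; rewrite /comp.
by apply: (clamp_cts (f := id)); exact: cts_id.
Qed.

Lemma unit_compact : compact [set: unit_interval R].
Proof.
have -> : [set: unit_interval R] = clampI @` `[0, 1].
  apply/seteqP; split=> t //= _; exists (set_val t); last exact: clampIK.
  by rewrite in_itv /= unit_itv.
apply: continuous_compact; last exact: segment_compact.
exact: continuous_subspaceT clampI_cts.
Qed.

Lemma unit_hausdorff : hausdorff_space (unit_interval R).
Proof.
apply: (@hausdorff_by_functions R) => x y xy; exists set_val; first exact: set_val_cts.
by move=> /val_inj.
Qed.

End Clamp.

(** * Cell structures *)

Definition bnd (R : realType) (b : bool) : R := if b then 1 else 0.
Arguments bnd {R} b.

(* [graph_structure] with cells parametrised by all of R (only [0, 1] matters)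
   and the quotient-topology axiom traded for the Hausdorff property. *)
Record cgraph (R : realType) (X : topologicalType) (V E : finType)
    (v : V -> X) (c : E -> R -> X) : Prop := CGraph {
  cg_inj : injective v;
  cg_cts : forall e, continuous (c e);
  cg_end : forall e b, exists u, c e (bnd b) = v u;
  cg_int : forall e t u, 0 < t < 1 -> c e t <> v u;
  cg_int_inj : forall e1 e2 t1 t2, 0 < t1 < 1 -> 0 < t2 < 1 ->
    c e1 t1 = c e2 t2 -> e1 = e2 /\ t1 = t2;
  cg_cover : forall x, (exists u, x = v u) \/
    exists e t, 0 < t < 1 /\ x = c e t;
  cg_hausdorff : hausdorff_space X
}.

Arguments cg_cts {R X V E v c} _ e.

Lemma itv01P (R : realType) (t : R) :
  0 <= t <= 1 -> (exists b, t = bnd b) \/ 0 < t < 1.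
Proof.
move=> /andP[]; rewrite le_eqVlt => /predU1P[<- _|t0].
  by left; exists false.
by rewrite le_eqVlt => /predU1P[->|t1]; [left; exists true|right; rewrite t0].
Qed.

Lemma bnd01 (R : realType) b : 0 <= (bnd b : R) <= 1.
Proof. by case: b; rewrite /= ?lexx ?ler01. Qed.

Lemma bigsetU_exists (T : Type) (I : finType) (F : I -> set T) :
  \big[setU/set0]_i F i = [set x | exists i, F i x].
Proof.
apply/seteqP; split=> x /=; last by move=> [i Fx]; rewrite (bigD1 i) //; left.
by apply: (big_ind (fun A : set T => A x -> exists i, F i x)) => // [A B hA hB [/hA|/hB]|i _ Fx];
  last by exists i.
Qed.

Section Gluing.
Variables (R : realType) (X : topologicalType) (V E : finType).
Variables (v : V -> X) (c : E -> R -> X).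
Hypothesis gr : cgraph v c.

Lemma cg_vertex_param e t u : 0 <= t <= 1 -> c e t = v u -> exists b, t = bnd b.
Proof. by move=> /itv01P[//|t01] /(cg_int gr t01). Qed.

Lemma cg_compact : compact [set: X].
Proof.
have -> : [set: X] = (\big[setU/set0]_u [set v u]) `|`
    \big[setU/set0]_e (c e @` `[0, 1]).
  rewrite !bigsetU_exists; apply/seteqP; split=> x //= _.
  case: (cg_cover gr x) => [[u ->]|[e [t [t01 ->]]]]; first by left; exists u.
  right; exists e, t => //.
  by move: t01 => /andP[t0 t1]; rewrite /= in_itv /= !ltW.
apply: compactU; apply: bigsetU_compact => i _; first exact: compact_set1.
by apply: continuous_compact; [apply/continuous_subspaceT/(cg_cts gr)|exact: segment_compact].
Qed.

(** The preimage of a closed set is a finite union of images of closed subsets of the compact cells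
    times [P]; these images are compact, hence closed in the Hausdorff space [X * P]. The parameter
    space [P] is there to glue homotopies, without knowing that a quotient map times an interval is
    again a quotient map. *)
Lemma cell_glue (P Z : topologicalType) (hv : V -> P -> Z) (he : E -> R -> P -> Z) :
  compact [set: P] -> hausdorff_space P ->
  (forall u, continuous (hv u)) ->
  (forall e, continuous (fun z : R * P => he e z.1 z.2)) ->
  (forall e b u, c e (bnd b) = v u -> forall p, he e (bnd b) p = hv u p) ->
  exists H : X * P -> Z, [/\ continuous H, forall u p, H (v u, p) = hv u p &
    forall e t p, 0 <= t <= 1 -> H (c e t, p) = he e t p].
Proof.
move=> cP hP chv che hev.
(* The prescribed values are consistent: a point is either one vertex or interior to one edge at one
   parameter, and [hev] covers the ends of edges. *)
have /choice[H HP] : forall z : X * P, exists y : Z,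
    (forall u, z.1 = v u -> y = hv u z.2) /\
    (forall e t, 0 <= t <= 1 -> z.1 = c e t -> y = he e t z.2).
  move=> [x p] /=; case: (cg_cover gr x) => [[u ->]|[e [t [t01 ->]]]].
    exists (hv u p); split; first by move=> u' /(cg_inj gr) ->.
    move=> e t t01 vu; have [b tb] := cg_vertex_param t01 (esym vu).
    by subst t; rewrite (hev e b u).
  exists (he e t p); split; first by move=> u /(cg_int gr t01).
  move=> e' t' /itv01P[[b ->]|t'01].
    by have [u ->] := cg_end gr e' b => /(cg_int gr t01).
  by move=> /(cg_int_inj gr t01 t'01)[-> ->].
have Hv u p : H (v u, p) = hv u p by have [h _] := HP (v u, p); exact: h.
have Hc e t p : 0 <= t <= 1 -> H (c e t, p) = he e t p.
  by move=> t01; have [_ h] := HP (c e t, p); exact: h.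
exists H; split=> //; apply/continuous_closedP => C cC.
pose Kv u := (fun p => (v u, p)) @` (hv u @^-1` C).
pose Ke e := (fun z : R * P => (c e z.1, z.2)) @`
  ((`[0, 1] `*` [set: P]) `&` ((fun z : R * P => he e z.1 z.2) @^-1` C)).
have -> : H @^-1` C = (\big[setU/set0]_u Kv u) `|` \big[setU/set0]_e Ke e.
  rewrite !bigsetU_exists; apply/seteqP; split=> [[x p]|z] /=.
    case: (cg_cover gr x) => [[u ->]|[e [t [/andP[t0 t1] ->]]]].
      by rewrite Hv => Ch; left; exists u, p.
    have t01 : 0 <= t <= 1 by rewrite !ltW.
    by rewrite Hc // => Ch; right; exists e; exists (t, p); rewrite /= ?in_itv.
  move=> [[u [p Cp <-]]|[e [[t p] /= [[+ _] Cp <-]]]]; first by rewrite Hv.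
  by rewrite in_itv /= => t01; rewrite Hc.
have hXP : hausdorff_space (X * P)%type := hausdorff_pair (cg_hausdorff gr) hP.
apply: closedU; apply: compact_closed => //; apply: bigsetU_compact => i _.
  apply: continuous_compact.
    apply: continuous_subspaceT; apply: cts_pair; [exact: cst_continuous|exact: cts_id].
  by apply: subclosed_compact cP _ => //; move/continuous_closedP: (chv i); apply.
apply: continuous_compact.
  apply: continuous_subspaceT; apply: cts_pair; last exact: cts_snd.
  exact: cts_comp (cg_cts gr i) (@cts_fst R P).
apply: compact_closedI; last by move/continuous_closedP: (che i); apply.
by apply: compact_setX => //; exact: segment_compact.
Qed.

Lemma cell_glue1 (Z : topologicalType) (hv : V -> Z) (he : E -> R -> Z) :
  (forall e, continuous (he e)) ->
  (forall e b u, c e (bnd b) = v u -> he e (bnd b) = hv u) ->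
  exists g : X -> Z, [/\ continuous g, forall u, g (v u) = hv u &
    forall e t, 0 <= t <= 1 -> g (c e t) = he e t].
Proof.
move=> che hev.
(* Data constant in the parameter are glued over the interval, and the result is restricted to the
   slice at 0. *)
have [|||H [cH Hv Hc]] := @cell_glue (unit_interval R) Z (fun u _ => hv u)
    (fun e t _ => he e t) (@unit_compact R) (@unit_hausdorff R).
- by move=> u; exact: cst_continuous.
- by move=> e; exact: cts_comp (che e) (@cts_fst R (unit_interval R)).
- by move=> e b u /hev.
exists (fun x => H (x, clampI 0)); split=> [|u|e t t01]; last 2 first.
- by rewrite Hv.
- by rewrite Hc.
apply: (cts_comp cH (f := fun x => (x, clampI 0))).
by apply: cts_pair; [exact: cts_id|exact: cst_continuous].
Qed.

(* On the open edge [c e0] the functions [k1 = t (1 - t)] and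
   [k2 = t ^ 2 (1 - t)] recover the parameter as [t = k2 / k1]. *)
Lemma edge_coordinates e0 : exists k1 k2 : X -> R,
  [/\ continuous k1, continuous k2,
      forall t, 0 <= t <= 1 -> k1 (c e0 t) = t * (1 - t) /\ k2 (c e0 t) = t * t * (1 - t) &
      forall x, 0 < k1 x <-> exists t, 0 < t < 1 /\ x = c e0 t].
Proof.
have [||k1 [ck1 k1v k1e]] := @cell_glue1 R (fun=> 0)
    (fun e t => if e == e0 then t * (1 - t) else 0).
- by move=> e; case: eqP => _; cts.
- by move=> e [] u _; case: eqP => //= _; ring.
have [||k2 [ck2 k2v k2e]] := @cell_glue1 R (fun=> 0)
    (fun e t => if e == e0 then t * t * (1 - t) else 0).
- by move=> e; case: eqP => _; cts.
- by move=> e [] u _; case: eqP => //= _; ring.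
exists k1, k2; split=> // [t t01|x].
  by rewrite k1e // k2e // eqxx.
split=> [|[t [/andP[t0 t1] ->]]]; last first.
  rewrite k1e; last by rewrite !ltW.
  by rewrite eqxx mulr_gt0 // subr_gt0.
case: (cg_cover gr x) => [[u ->]|[e [t [t01 ->]]]]; first by rewrite k1v ltxx.
have /andP[t0 t1] := t01.
rewrite k1e; last by rewrite !ltW.
by case: eqP => [<- _|]; [exists t|rewrite ltxx].
Qed.

End Gluing.

(** Only the Hausdorff property needs an argument: continuous real functions, defined cell by cell,
    separate the points. *)
Lemma graph_structure_cgraph (R : realType) (X : topologicalType) (V E : finType)
    (v : V -> X) (c : E -> unit_interval R -> X) :
  graph_structure v c -> cgraph v (fun e t => c e (clampI t)).
Proof.
move=> gs.
have clI (t : R) : 0 <= t <= 1 -> set_val (clampI t) = t by exact: clamp_id.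
have oo_cc (t : R) : 0 < t < 1 -> 0 <= t <= 1 by move=> /andP[? ?]; rewrite !ltW.
have cc e : continuous (c e).
  by apply/continuousP => U /(cw_topology gs) /(_ e).
have endp e (b : bool) : exists u, c e (clampI (bnd b)) = v u.
  have [|u _ <-] := cw_boundary gs e (t := clampI (bnd b)); last by exists u.
  by rewrite clI ?bnd01 //; case: b; [right|left].
have int e (t : R) u : 0 < t < 1 -> c e (clampI t) <> v u.
  move=> t01 cv; apply: (cw_interior gs (e := e) (t := clampI t)).
    by rewrite clI // oo_cc.
  by exists u.
have intinj e1 e2 (t1 t2 : R) : 0 < t1 < 1 -> 0 < t2 < 1 ->
    c e1 (clampI t1) = c e2 (clampI t2) -> e1 = e2 /\ t1 = t2.
  move=> h1 h2 /(cw_interior_inj gs).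
  rewrite !clI ?oo_cc // => /(_ h1 h2)[-> /(congr1 set_val)].
  by rewrite !clI ?oo_cc.
have cover x : (exists u, x = v u) \/
    exists e (t : R), 0 < t < 1 /\ x = c e (clampI t).
  case: (cw_cover gs x) => [[u _ <-]|[e [t _ <-]]]; first by left; exists u.
  case: (itv01P (unit_itv t)) => [[b tb]|t01].
    by left; have [u hu] := endp e b; exists u; rewrite -hu -tb clampIK.
  by right; exists e, (set_val t); rewrite clampIK.
(* [cell_glue] presupposes the Hausdorff property, so here continuity is read off the quotient
   topology [cw_topology]. *)
have glueR (hv : V -> R) (he : E -> R -> R) : (forall e, continuous (he e)) ->
    (forall e b u, c e (clampI (bnd b)) = v u -> he e (bnd b) = hv u) ->
    exists g : X -> R, [/\ continuous g, forall u, g (v u) = hv u &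
      forall e t, 0 <= t <= 1 -> g (c e (clampI t)) = he e t].
  move=> che hev.
  have /choice[g gP] : forall x, exists y : R, (forall u, x = v u -> y = hv u) /\
      (forall e t, 0 <= t <= 1 -> x = c e (clampI t) -> y = he e t).
    move=> x; case: (cover x) => [[u ->]|[e [t [t01 ->]]]].
      exists (hv u); split; first by move=> u' /(cw_vertex_inj gs) ->.
      move=> e t /itv01P[[b ->] /esym /hev -> //|t01 /esym].
      by move=> /(int _ _ _ t01).
    exists (he e t); split; first by move=> u /(int _ _ _ t01).
    move=> e' t' /itv01P[[b ->]|t'01].
      by have [u ->] := endp e' b => /(int _ _ _ t01).
    by move=> /(intinj _ _ _ _ t01 t'01)[-> ->].
  have ge e (t : R) : 0 <= t <= 1 -> g (c e (clampI t)) = he e t.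
    by move=> t01; have [_ /(_ e t t01 erefl)] := gP (c e (clampI t)).
  exists g; split=> //; last by move=> u; have [/(_ u erefl)] := gP (v u).
  apply/continuousP => U oU; apply/(cw_topology gs) => e.
  have -> : c e @^-1` (g @^-1` U) = (fun t => he e (set_val t)) @^-1` U.
    apply/seteqP; split=> t /=; rewrite -(ge e (set_val t)) ?clampIK //; exact: unit_itv.
  have : continuous (fun t : unit_interval R => he e (set_val t)).
    exact: cts_comp (che e) (@set_val_cts R).
  by move/continuousP; apply.
split=> //; first exact: (cw_vertex_inj gs).
  by move=> e; exact: cts_comp (cc e) (@clampI_cts R).
have m0 : Num.max 0 (-1) = 0 :> R by rewrite max_l ?lerN10.
have m1 : Num.max 0 1 = 1 :> R by rewrite max_r ?ler01.
apply: (@hausdorff_by_functions R) => x y.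
(* After a possible exchange, either both points are vertices or [x] is interior to an edge. *)
wlog : x y / (exists u, x = v u) -> (exists u, y = v u).
  move=> W xy; case: (pselect ((exists u, x = v u) -> (exists u, y = v u))) =>
    [h|/not_implyP[xv yv]].
    by apply: W.
  have [||g cg /nesym gxy] := W y x; [by move=> _|by move/esym|by exists g].
case: (cover x) => [[u ->] /(_ (ex_intro _ u erefl))[w -> uw]|[e [s [s01 ->]]] _ xy].
  (* A tent at the vertex [u]: it falls linearly from 1 to 0 on the first half of every edge end
     attached to [u] and vanishes elsewhere. *)
  have [|| g [cg gv ge]] := glueR (fun w => (w == u)%:R)
    (fun e t => Num.max 0 (1 - 2 * t) * (`[< c e (clampI 0) = v u >])%:R +
                Num.max 0 (2 * t - 1) * (`[< c e (clampI 1) = v u >])%:R).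
  - by move=> e; cts.
  - move=> e [] w' /= cw.
      rewrite (_ : 1 - _ = -1 :> R); last by ring.
      rewrite (_ : _ - 1 = 1 :> R); last by ring.
      rewrite m0 m1 mul0r mul1r add0r.
      congr (nat_of_bool _)%:R; rewrite cw; apply/asboolP/eqP => [|->//].
      exact: (cw_vertex_inj gs).
    rewrite (_ : 1 - _ = 1 :> R); last by ring.
    rewrite (_ : _ - 1 = -1 :> R); last by ring.
    rewrite m0 m1 mul0r mul1r addr0.
    congr (nat_of_bool _)%:R; rewrite cw; apply/asboolP/eqP => [|->//].
    exact: (cw_vertex_inj gs).
  exists g => //; rewrite !gv eqxx; case: eqP => [wu|_ /eqP]; first by rewrite wu in uw.
  by rewrite oner_eq0.
have /andP[s0 s1] := s01.
(* A tent on the edge [e]: it vanishes at both ends and takes its maximum [s * (1 - s)] only at the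
   parameter [s] of [x]. *)
have [|| g [cg gv ge]] := glueR (fun w => 0)
    (fun e' t => if e' == e then Num.min (t * (1 - s)) ((1 - t) * s) else 0).
- by move=> e'; case: eqP => _; cts.
- move=> e' b w _; case: eqP => // _.
  case: b => /=.
    by rewrite subrr mul0r mul1r min_r // subr_ge0 ltW.
  by rewrite mul0r subr0 mul1r min_l // ltW.
exists g => //; rewrite ge ?oo_cc // eqxx (mulrC s) minxx.
have sp : 0 < (1 - s) * s by rewrite mulr_gt0 ?subr_gt0.
case: (cover y) => [[u ->]|[e' [t [t01 ytE]]]].
  by rewrite gv => gxy; move: sp; rewrite gxy ltxx.
rewrite ytE ge ?oo_cc //; case: eqP => [ee'|_ gxy]; last by move: sp; rewrite gxy ltxx.
have /andP[t0 t1] := t01.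
have st : s <> t by move=> st; apply: xy; rewrite ytE st ee'.
move=> gxy; apply: st.
case: (ltgtP s t) => // st; exfalso; move: gxy; rewrite /Num.min; case: ifP; nra.
Qed.

(** * Two tokens on a graph *)

Section Tokens.
Variables (S : finType) (adj : rel S).
Hypotheses (adjC : symmetric adj) (adj_irr : irreflexive adj).

(** Pauses count as steps, because one token waits while the other moves. *)
Definition estep (a b : S) := (a == b) || adj a b.

(** Equality in the edge-path groupoid: full vertex sequences, up to deleting pauses and backtracks.
    The lists need not be walks; by [weq_homot] being a walk is invariant. *)
Inductive weq : seq S -> seq S -> Prop :=
| weq_refl l : weq l l
| weq_sym l l' : weq l l' -> weq l' l
| weq_trans l l' l'' : weq l l' -> weq l' l'' -> weq l l''
| weq_stay p a q : weq (p ++ [:: a, a & q]) (p ++ a :: q)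
| weq_back p a b q : adj a b -> weq (p ++ [:: a, b, a & q]) (p ++ a :: q).

Lemma weq_cat l l' p q : weq l l' -> weq (p ++ l ++ q) (p ++ l' ++ q).
Proof.
elim=> {l l'} [l|l l' _|l l' l'' _ h _|r a s|r a b s ab].
- exact: weq_refl.
- exact: weq_sym.
- exact: weq_trans.
- by have := weq_stay (p ++ r) a (s ++ q); rewrite -!catA.
- by have := weq_back (p ++ r) (s ++ q) ab; rewrite -!catA.
Qed.

Lemma weq_join a l l' r r' : weq (a :: l) (a :: l') ->
  weq (last a l :: r) (last a l :: r') -> weq (a :: l ++ r) (a :: l' ++ r').
Proof.
move=> ll' rr'; apply: (weq_trans (l' := a :: l ++ r')).
  by rewrite -!cat_cons lastI !cat_rcons; have := weq_cat (belast a l) [::] rr'; rewrite !cats0.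
by have := weq_cat [::] r' ll'.
Qed.

(** Only one token moves at a time. Being distinct before and after the step, the tokens cannot meet
    during it: the waiting one sits at a vertex off the edge that the other traverses. *)
Definition tstep (x y : S * S) :=
  [&& x.1 != x.2, y.1 != y.2 &
   ((x.1 == y.1) && estep x.2 y.2) || ((x.2 == y.2) && estep x.1 y.1)].

(** The schedule [m] has one clock for both tokens; each of its projections has to agree with the
    prescribed walk only up to [weq]. [P] and [Q] omit their starting vertices. *)
Definition reach (a b : S) (P Q : seq S) (a' b' : S) : Prop :=
  exists m, [/\ path tstep (a, b) m, last (a, b) m = (a', b'),
    weq (a :: map fst m) (a :: P) & weq (b :: map snd m) (b :: Q)].

Lemma reach_refl a b : reach a b [::] [::] a b.
Proof. by exists [::]; split=> //; exact: weq_refl. Qed.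

Lemma reach_weq a b P Q P' Q' a' b' : weq (a :: P) (a :: P') ->
  weq (b :: Q) (b :: Q') -> reach a b P Q a' b' -> reach a b P' Q' a' b'.
Proof.
move=> PP' QQ' [m [pm lm wP wQ]]; exists m; split=> //.
  exact: weq_trans PP'.
exact: weq_trans QQ'.
Qed.

Lemma reach_trans a b P Q a' b' P' Q' a'' b'' :
  reach a b P Q a' b' -> reach a' b' P' Q' a'' b'' ->
  reach a b (P ++ P') (Q ++ Q') a'' b''.
Proof.
move=> [m [pm lm wP wQ]] [m' [pm' lm' wP' wQ']]; exists (m ++ m').
have la : last a (map fst m) = a' by have := last_map fst m (a, b); rewrite lm.
have lb : last b (map snd m) = b' by have := last_map snd m (a, b); rewrite lm.
split; rewrite ?map_cat.
- by rewrite cat_path pm lm.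
- by rewrite last_cat lm.
- by apply: weq_join; rewrite ?la.
- by apply: weq_join; rewrite ?lb.
Qed.

Lemma reach_swap a b P Q a' b' : reach a b P Q a' b' -> reach b a Q P b' a'.
Proof.
move=> [m [pm lm wP wQ]]; pose sw (x : S * S) := (x.2, x.1).
exists (map sw m); rewrite -[(b, a)]/(sw (a, b)); split.
- rewrite path_map; apply: sub_path pm => -[x y] [z t].
  move=> /and3P[/= xy zt h]; apply/and3P; split=> /=; last by rewrite orbC.
    by rewrite eq_sym.
  by rewrite eq_sym.
- by rewrite last_map lm.
- by rewrite -map_comp.
- by rewrite -map_comp.
Qed.

Lemma reach_move1 a b a' : a != b -> a' != b -> adj a a' ->
  reach a b [:: a'] [::] a' b.
Proof.
move=> ab a'b aa'; exists [:: (a', b)]; split=> //=.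
- by rewrite /tstep /estep /= ab a'b aa' eqxx orbT orbT.
- exact: weq_refl.
- exact: (weq_stay [::]).
Qed.

Lemma reach_move2 a b b' : a != b -> a != b' -> adj b b' ->
  reach a b [::] [:: b'] a b'.
Proof.
by move=> ab ab' bb'; apply: reach_swap; apply: reach_move1; rewrite 1?eq_sym.
Qed.

Lemma walk_reverse x p : path estep x p ->
  exists q, [/\ path estep (last x p) q, last (last x p) q = x &
    weq (x :: p ++ q) [:: x]].
Proof.
elim: p x => [|y p IHp] x /=; first by exists [::]; split=> //; exact: weq_refl.
move=> /andP[xy /IHp[q [pq lq wq]]]; exists (rcons q x); split.
- by rewrite rcons_path pq lq; move: xy; rewrite /estep eq_sym adjC.
- by rewrite last_rcons.
- rewrite -cats1; apply: (weq_trans (l' := [:: x; y; x])).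
    by have := weq_cat [:: x] [:: x] wq; rewrite /= -catA.
  case/predU1P: xy => [->|xy]; last exact: (weq_back [::]).
  by apply: weq_trans (weq_stay [::] y [::]); exact: (weq_stay [::]).
Qed.

Variables (w n1 n2 n3 : S).
Hypotheses (wn1 : adj w n1) (wn2 : adj w n2) (wn3 : adj w n3).
Hypotheses (n12 : n1 != n2) (n13 : n1 != n3) (n23 : n2 != n3).
Hypothesis conn : forall x y, exists2 p, path adj x p & last x p = y.

Lemma adj_neq a b : adj a b -> a != b.
Proof. by apply: contraL => /eqP->; rewrite adj_irr. Qed.

Lemma avoid2 (c d : S) : exists2 e, (e == n1) || (e == n2) || (e == n3) &
  (e != c) && (e != d).
Proof.
case: (boolP ((n1 != c) && (n1 != d))) => [h|h1]; first by exists n1; rewrite ?eqxx.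
case: (boolP ((n2 != c) && (n2 != d))) => [h|h2]; first by exists n2; rewrite ?eqxx ?orbT.
exists n3; first by rewrite eqxx orbT.
move: h1 h2; rewrite !negb_and !negbK.
move=> /orP[]/eqP e1 /orP[]/eqP e2.
- by move: n12; rewrite e1 e2 eqxx.
- by rewrite -e1 -e2 ![n3 == _]eq_sym n13 n23.
- by rewrite -e1 -e2 ![n3 == _]eq_sym n13 n23.
- by move: n12; rewrite e1 e2 eqxx.
Qed.

Lemma ess_avoid2 c d : exists2 e, adj w e & (e != c) && (e != d).
Proof.
by have [e /orP[/orP[]|] /eqP -> h] := avoid2 c d; [exists n1|exists n2|exists n3].
Qed.

(** The second token withdraws from [b] to [e], the first one runs through [b] to [d], and the
    second one returns. Its excursion [b, e, b] is a backtrack. *)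
Lemma reach_siding b c d e : adj b c -> adj b d -> adj b e ->
  c != d -> e != c -> e != d -> reach c b [:: b; d] [::] d b.
Proof.
move=> bc bd be cd ec ed.
have cb : c != b by rewrite eq_sym adj_neq.
have db : d != b by rewrite eq_sym adj_neq.
have eb : e != b by rewrite eq_sym adj_neq.
have cb' : adj c b by rewrite adjC.
have h1 : reach c b [::] [:: e] c e by apply: reach_move2; rewrite // eq_sym.
have h2 : reach c e [:: b] [::] b e.
  by apply: reach_move1; rewrite // eq_sym.
have h3 : reach b e [:: d] [::] d e.
  by apply: reach_move1; rewrite // eq_sym.
have h4 : reach d e [::] [:: b] d b.
  by apply: reach_move2 => //; rewrite 1?eq_sym // adjC.
apply: reach_weq (reach_trans h1 (reach_trans h2 (reach_trans h3 h4))).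
  exact: weq_refl.
exact: (weq_back [::]).
Qed.

Lemma reach_cross_ess c d : adj w c -> adj w d -> c != d ->
  reach c w [:: w; d] [::] d w.
Proof.
move=> wc wd cd; have [e we /andP[ec ed]] := ess_avoid2 c d.
exact: (@reach_siding w c d e).
Qed.

(* At a vertex of degree 2 on the way to [w], the crossing is pushed one step
   towards [w]; at [w] the third branch is used as a siding. *)
Lemma reach_cross b c d : adj b c -> adj b d -> c != d ->
  reach c b [:: b; d] [::] d b.
Proof.
have [p] := conn b w; move: {2}(size p) (leqnn (size p)) => n.
elim: n b c d p => [|n IHn] b c d p szp pp lp bc bd cd.
  have {p szp pp lp} bw : b = w by case: p szp lp {pp}.
  by subst b; exact: reach_cross_ess.
have cb : c != b by rewrite eq_sym adj_neq.
have db : d != b by rewrite eq_sym adj_neq.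
have cb' : adj c b by rewrite adjC.
have db' : adj d b by rewrite adjC.
have [bw|bw] := eqVneq b w; first by subst b; exact: reach_cross_ess.
case: (pselect (exists e, [/\ adj b e, e != c & e != d])) => [[e [be ec ed]]|no].
  exact: (@reach_siding b c d e).
case: p szp pp lp => [_ _ /= /eqP|x p]; first by rewrite (negPf bw).
rewrite /= ltnS => szp /andP[bx pp] lp.
(* [z] follows [x] on the path to [w]; if the path stops at [x = w], it is any neighbour of [w]
   other than [b]. If [z = b], the path has come back to [b] and a shorter one remains, so
   afterwards [z != b]. *)
have [z zp] : exists z, [/\ adj x z &
    z = b -> exists2 q, (size q <= n)%N & path adj b q /\ last b q = w].
  case: p szp pp lp => [_ _ /= xw|z p /= szp /andP[xz pp] lp].
    have [z wz /andP[zb _]] := ess_avoid2 b b; exists z.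
    by rewrite xw; split=> // /eqP; rewrite (negPf zb).
  by exists z; split=> // zb; exists p; [exact: ltnW|rewrite -zb].
have [zb|zb] := eqVneq z b.
  have [_ /(_ zb)[q szq [pq lq]]] := zp; exact: (IHn b c d q).
have {zp} [xz _] := zp.
have : (x == c) || (x == d).
  by apply: contra_notT no; rewrite negb_or => /andP[xc xd]; exists x.
case/orP => /eqP xE; subst x.
  (* The way to [w] leads through [c]: both tokens back up, to [z] and [c], cross at [c] by
     induction, and advance again. The first token runs [c, z, c, b, d] and the second [b, c, b]. *)
  have cz : z != c by rewrite eq_sym adj_neq.
  have h1 : reach c b [:: z] [::] z b by exact: reach_move1.
  have h2 : reach z b [::] [:: c] z c by apply: reach_move2.
  have h3 : reach z c [:: c; b] [::] b c by apply: (IHn c z b p).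
  have h4 : reach b c [:: d] [::] d c.
    by apply: reach_move1; rewrite // eq_sym.
  have h5 : reach d c [::] [:: b] d b by apply: reach_move2; rewrite // eq_sym.
  have := reach_trans h1 (reach_trans h2 (reach_trans h3 (reach_trans h4 h5))).
  apply: reach_weq; first exact: (weq_back [::]).
  apply: weq_trans (weq_back [::] [::] bc); exact: (weq_refl _).
(* The way to [w] leads through [d]: both tokens advance, to [b] and [d], and cross at [d] by
   induction. The first token runs [c, b, d, z, d] and the second [b, d, b]. *)
have dz : z != d by rewrite eq_sym adj_neq.
have h1 : reach c b [::] [:: d] c d by apply: reach_move2.
have h2 : reach c d [:: b] [::] b d by apply: reach_move1; rewrite // eq_sym.
have h3 : reach b d [:: d; z] [::] z d by apply: (IHn d b z p); rewrite // eq_sym.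
have h4 : reach z d [::] [:: b] z b by apply: reach_move2.
have h5 : reach z b [:: d] [::] d b.
  by apply: reach_move1; rewrite // adjC.
have := reach_trans h1 (reach_trans h2 (reach_trans h3 (reach_trans h4 h5))).
apply: reach_weq; last exact: (weq_back [::]).
exact: (weq_back [:: c; b]).
Qed.

(** The second token stays at [b] up to backtracks. The induction is on length, since pauses and
    backtracks of [P] are removed on the way. *)
Lemma reach_walk1 a b P : path estep a P -> a != b -> last a P != b ->
  reach a b P [::] (last a P) b.
Proof.
move: {2}(size P) (leqnn (size P)) => n.
elim: n a P => [|n IHn] a [|x P] //=; rewrite ?ltnS; try by move=> *; exact: reach_refl.
move=> szP /andP[ax pP] ab lP.
have {ax} [xa|ax] : a = x \/ adj a x.
- by case/orP: ax => [/eqP|]; [left|right].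
- subst x; apply: reach_weq (weq_sym (weq_stay [::] a P)) (weq_refl _) _.
  exact: IHn.
have [xb|xb] := eqVneq x b; last first.
  exact: (reach_trans (reach_move1 ab xb ax) (IHn x P szP pP xb lP)).
(* The next vertex is occupied, so the step after it decides: a pause at [b] is dropped, a return to
   [a] cancels, and anything else is a crossing. [P] cannot end here, by [lP]. *)
subst x; case: P szP pP lP => [|y P] /=; first by rewrite eqxx.
move=> szP /andP[+ pP] lP; rewrite /estep => /predU1P[by_|by_].
  subst y.
  apply: reach_weq (weq_sym (weq_stay [:: a] b P)) (weq_refl _) _.
  by apply: (IHn a (b :: P)) => //=; rewrite /estep ax orbT pP.
have yb : y != b by rewrite eq_sym adj_neq.
have [ay|ay] := eqVneq a y.
  subst y; apply: reach_weq (weq_sym (weq_back [::] P ax)) (weq_refl _) _.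
  by apply: IHn => //; exact: ltnW.
have h : reach y b P [::] (last y P) b by apply: IHn => //; exact: ltnW.
apply: (reach_trans (P := [:: b; y]) (Q := [::]) _ h).
by apply: reach_cross; rewrite // adjC.
Qed.

(** The first token performs [P] and goes on along [r] to a parking place, the second performs [Q],
    and the first returns along the reverse of [r]. The parking place has to differ from both ends
    of [Q]; one of three neighbours of [w] does. *)
Theorem reach_walks a b P Q : path estep a P -> path estep b Q ->
  a != b -> last a P != last b Q -> reach a b P Q (last a P) (last b Q).
Proof.
move=> pP pQ ab lPQ.
have [r pr lr] : exists2 r, path estep (last a P) r &
    (last (last a P) r != b) && (last (last a P) r != last b Q).
  have [e _ h] := ess_avoid2 b (last b Q); have [r pr lr] := conn (last a P) e.
  by exists r; rewrite ?lr //; apply: sub_path pr => x y; rewrite /estep => ->; rewrite orbT.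
have [q [pq lq wq]] := walk_reverse pr.
have /andP[rb rQ] := lr.
have h1 : reach a b (P ++ r) [::] (last (last a P) r) b.
  rewrite -last_cat; apply: reach_walk1; rewrite ?last_cat //.
  by rewrite cat_path pP.
have h2 : reach (last (last a P) r) b [::] Q (last (last a P) r) (last b Q).
  by apply: reach_swap; apply: reach_walk1; rewrite 1?eq_sym.
have h3 : reach (last (last a P) r) (last b Q) q [::] (last a P) (last b Q).
  by rewrite -{2}lq; apply: reach_walk1; rewrite ?lq.
apply: reach_weq (reach_trans h1 (reach_trans h2 h3)); last first.
  by rewrite /= cats0; exact: weq_refl.
rewrite /= -catA -{2}(cats0 P); apply: weq_join; first exact: weq_refl.
exact: wq.
Qed.

End Tokens.

(** * Homotopies of paths *)

Section PathHomotopy.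
Variables (R : realType) (G : topologicalType).
Implicit Types a b c d : R -> G.

Definition pcat a b (t : R) : G := if t <= 2^-1 then a (2 * t) else b (2 * t - 1).

Definition path_inv a (t : R) : G := a (1 - t).

(* Paths are functions on all of R of which only the values on [0, 1] matter. *)
Definition homot a b : Prop := exists H : R * R -> G, [/\ continuous H,
  forall t, 0 <= t <= 1 -> H (t, 0) = a t /\ H (t, 1) = b t &
  forall s, H (0, s) = a 0 /\ H (1, s) = a 1].

Lemma half_le01 : (2^-1 : R) = 1 / 2. Proof. by rewrite div1r. Qed.

Lemma pcatE a b t : pcat a b t = if t <= 1 / 2 then a (2 * t) else b (2 * t - 1).
Proof. by rewrite /pcat div1r. Qed.

Lemma pcat_cts a b : continuous a -> continuous b -> a 1 = b 0 ->
  continuous (pcat a b).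
Proof.
move=> ca cb ab; rewrite /pcat.
apply: (@cts_if R R G id 2^-1 (fun t => a (2 * t)) (fun t => b (2 * t - 1))).
- exact: cts_id.
- by apply: (cts_comp ca (f := fun t : R => 2 * t)); cts.
- by apply: (cts_comp cb (f := fun t : R => 2 * t - 1)); cts.
- by move=> t ->; rewrite divff ?subrr // pnatr_eq0.
Qed.

Lemma pcat0 a b : pcat a b 0 = a 0.
Proof. by rewrite /pcat invr_ge0 ler0n mulr0. Qed.

Lemma pcat1 a b : pcat a b 1 = b 1.
Proof.
rewrite /pcat; case: ifPn => h; last by congr b; ring.
by exfalso; move: h; rewrite half_le01; lra.
Qed.

Lemma path_inv_cts a : continuous a -> continuous (path_inv a).
Proof. by move=> ca; rewrite /path_inv; apply: (cts_comp ca (f := fun t : R => 1 - t)); cts. Qed.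

Lemma homot_eq a b : continuous a -> (forall t, 0 <= t <= 1 -> a t = b t) ->
  homot a b.
Proof.
move=> ca ab; exists (fun z => a z.1); split=> //.
  exact: cts_comp ca (@cts_fst R R).
by move=> t t01; rewrite ab.
Qed.

Lemma homot_refl a : continuous a -> homot a a.
Proof. by move=> ca; apply: homot_eq. Qed.

Lemma homot_ends a b : homot a b -> a 0 = b 0 /\ a 1 = b 1.
Proof.
move=> [H [_ h s]]; split.
  by have [|_ <-] := h 0; [rewrite lexx ler01|case: (s 1)].
by have [|_ <-] := h 1; [rewrite lexx ler01|case: (s 1)].
Qed.

Lemma homot_sym a b : homot a b -> homot b a.
Proof.
move=> hab; have [e0 e1] := homot_ends hab; move: hab => [H [cH h s]].
exists (fun z => H (z.1, 1 - z.2)); split.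
- by apply: (cts_comp cH (f := fun z : R * R => (z.1, 1 - z.2))); cts.
- by move=> t /h[h0 h1] /=; rewrite subr0 subrr.
- by move=> t /=; have [-> ->] := s (1 - t).
Qed.

Lemma homot_trans b a c : homot a b -> homot b c -> homot a c.
Proof.
move=> hab; have [e0 e1] := homot_ends hab; move: hab => [H [cH h s]].
move=> [K [cK k r]].
(* The two halves are known to agree at height 1/2 only for parameters in [0, 1], hence the
   [clamp]. *)
exists (fun z => if z.2 <= 2^-1 then H (clamp z.1, 2 * z.2)
  else K (clamp z.1, 2 * z.2 - 1)); split=> [|t t01|t] /=.
- apply: (@cts_if R _ _ snd 2^-1 (fun z => H (clamp z.1, 2 * z.2))
     (fun z => K (clamp z.1, 2 * z.2 - 1))).
  + exact: cts_snd.
  + apply: (cts_comp cH (f := fun z : R * R => (clamp z.1, 2 * z.2))).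
    by apply: cts_pair; [apply: clamp_cts|]; cts.
  + apply: (cts_comp cK (f := fun z : R * R => (clamp z.1, 2 * z.2 - 1))).
    by apply: cts_pair; [apply: clamp_cts|]; cts.
  + move=> z ->; rewrite divff ?pnatr_eq0 // subrr.
    by have [_ ->] := h _ (clamp_itv z.1); have [-> _] := k _ (clamp_itv z.1).
- rewrite invr_ge0 ler0n mulr0 clamp_id //; have [-> _] := h _ t01.
  have -> : (1 <= 2^-1 :> R) = false by apply/negbTE; rewrite half_le01; lra.
  by rewrite (_ : 2 * 1 - 1 = 1 :> R); [have [_ ->] := k _ t01|ring].
- rewrite clamp0 clamp1; case: ifP => _; first by have [-> ->] := s (2 * t).
  by have [-> ->] := r (2 * t - 1); rewrite -e0 -e1.
Qed.

Lemma homot_pcat a b a' b' : homot a a' -> homot b b' -> a 1 = b 0 ->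
  homot (pcat a b) (pcat a' b').
Proof.
move=> [H [cH h s]] [K [cK k r]] ab.
exists (fun z => if z.1 <= 2^-1 then H (2 * z.1, z.2)
  else K (2 * z.1 - 1, z.2)); split=> [|t /andP[t0 t1]|t] /=.
- apply: (@cts_if R _ _ fst 2^-1 (fun z => H (2 * z.1, z.2))
     (fun z => K (2 * z.1 - 1, z.2))).
  + exact: cts_fst.
  + by apply: (cts_comp cH (f := fun z : R * R => (2 * z.1, z.2))); cts.
  + by apply: (cts_comp cK (f := fun z : R * R => (2 * z.1 - 1, z.2))); cts.
  + move=> z ->; rewrite divff ?pnatr_eq0 // subrr.
    by have [_ ->] := s z.2; have [-> _] := r z.2.
- rewrite /pcat half_le01; case: ifP => th; first by apply: h; lra.
  by apply: k; lra.
- rewrite pcat0 pcat1 invr_ge0 ler0n mulr0; have [-> _] := s t.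
  have -> : (1 <= 2^-1 :> R) = false by apply/negbTE; rewrite half_le01; lra.
  by rewrite (_ : 2 * 1 - 1 = 1 :> R); [have [_ ->] := r t|ring].
Qed.

(* The groupoid laws are reparametrisations, hence instances of this straight-line
   homotopy in the parameter space. *)
Lemma homot_plane (Q : R * R -> G) (f1 f2 g1 g2 : R -> R) :
  continuous Q -> continuous f1 -> continuous f2 -> continuous g1 ->
  continuous g2 -> f1 0 = g1 0 -> f2 0 = g2 0 -> f1 1 = g1 1 -> f2 1 = g2 1 ->
  homot (fun t => Q (f1 t, f2 t)) (fun t => Q (g1 t, g2 t)).
Proof.
move=> cQ cf1 cf2 cg1 cg2 e10 e20 e11 e21.
have c1 (f : R -> R) : continuous f -> continuous (fun z : R * R => f z.1).
  by move=> cf; exact: cts_comp cf (@cts_fst R R).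
exists (fun z => Q ((1 - z.2) * f1 z.1 + z.2 * g1 z.1,
                    (1 - z.2) * f2 z.1 + z.2 * g2 z.1)); split.
- apply: (cts_comp cQ (f := fun z : R * R => ((1 - z.2) * f1 z.1 + z.2 * g1 z.1,
                    (1 - z.2) * f2 z.1 + z.2 * g2 z.1))).
  by cts; exact: c1.
- by move=> t _ /=; rewrite !(subr0, subrr, mul0r, mul1r, add0r, addr0).
- by move=> t /=; rewrite e10 e20 e11 e21 -!mulrDl subrK !mul1r.
Qed.

Lemma homot_reparam a (f g : R -> R) : continuous a -> continuous f ->
  continuous g -> f 0 = g 0 -> f 1 = g 1 ->
  homot (fun t => a (f t)) (fun t => a (g t)).
Proof.
move=> ca cf cg e0 e1.
apply: (homot_plane (Q := fun z => a z.1) (f2 := fun=> 0) (g2 := fun=> 0)) => //.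
- exact: cts_comp ca (@cts_fst R R).
- exact: cst_continuous.
- exact: cst_continuous.
Qed.

Lemma pcatA a b c : continuous a -> continuous b -> continuous c ->
  a 1 = b 0 -> b 1 = c 0 ->
  homot (pcat (pcat a b) c) (pcat a (pcat b c)).
Proof.
move=> ca cb cc ab bc.
have cabc : continuous (pcat a (pcat b c)).
  by apply: pcat_cts => //; [exact: pcat_cts|rewrite pcat0].
(* The usual reparametrisation sends 1/4 to 1/2 and 1/2 to 3/4. Its slopes 2, 1, 1/2 decrease, so it
   is a minimum of three affine functions. *)
pose f (t : R) := Num.min (2 * t) (Num.min (t + 1 / 4) ((t + 1) / 2)).
apply: (@homot_trans (fun t => pcat a (pcat b c) (f t))); last first.
  apply: (homot_reparam (g := id)) => //; rewrite /f; [by cts|exact: cts_id| |].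
    rewrite mulr0 add0r min_l //; rewrite le_min; apply/andP; split; lra.
  rewrite min_r; last by rewrite ge_min; apply/orP; right; lra.
  rewrite min_r; lra.
apply: homot_eq.
  by apply: pcat_cts => //; [exact: pcat_cts|rewrite pcat1].
move=> t /andP[t0 t1]; rewrite /f /pcat half_le01.
have [t4|t4] := lerP t (1 / 4).
  rewrite (min_l (y := Num.min _ _)); last by rewrite le_min; apply/andP; split; lra.
  have -> : t <= 1 / 2 by lra.
  have -> : 2 * t <= 1 / 2 by lra.
  by [].
rewrite (min_r (x := 2 * t)); last by rewrite ge_min; apply/orP; left; lra.
have [t2|t2] := lerP t (1 / 2).
  rewrite min_l; last by lra.
  have -> : (2 * t <= 1 / 2) = false by apply/negbTE; lra.
  have -> : (t + 1 / 4 <= 1 / 2) = (t <= 1 / 4) by apply/idP/idP; lra.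
  rewrite leNgt t4 /=.
  have -> : 2 * (t + 1 / 4) - 1 <= 1 / 2 by lra.
  by congr b; lra.
rewrite min_r; last by lra.
have -> : ((t + 1) * (1 / 2) <= 1 / 2) = false by apply/negbTE; lra.
have -> : (2 * ((t + 1) * (1 / 2)) - 1 <= 1 / 2) = false by apply/negbTE; lra.
by congr c; lra.
Qed.

Lemma pcat1l a : continuous a -> homot (pcat (fun=> a 0) a) a.
Proof.
move=> ca; apply: (@homot_trans (fun t => a (Num.max 0 (2 * t - 1)))); last first.
  apply: (homot_reparam (g := id)) => //; [by cts|exact: cts_id| |].
    by rewrite max_l //; lra.
  by rewrite max_r; lra.
apply: homot_eq; first by apply: pcat_cts => //; exact: cst_continuous.
move=> t t01; rewrite /pcat half_le01; case: ifP => th.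
  by rewrite max_l //; lra.
by rewrite max_r //; lra.
Qed.

Lemma pcat1r a : continuous a -> homot (pcat a (fun=> a 1)) a.
Proof.
move=> ca; apply: (@homot_trans (fun t => a (Num.min (2 * t) 1))); last first.
  apply: (homot_reparam (g := id)) => //; [by cts|exact: cts_id| |].
    by rewrite min_l //; lra.
  by rewrite min_r //; lra.
apply: homot_eq; first by apply: pcat_cts => //; exact: cst_continuous.
move=> t t01; rewrite /pcat half_le01; case: ifP => th.
  by rewrite min_l //; lra.
by rewrite min_r //; lra.
Qed.

Definition aff (s t u : R) : R := (1 - u) * s + u * t.

Lemma aff_cts s t : continuous (aff s t).
Proof. by rewrite /aff; cts. Qed.

Lemma aff0 s t : aff s t 0 = s. Proof. by rewrite /aff; ring. Qed.
Lemma aff1 s t : aff s t 1 = t. Proof. by rewrite /aff; ring. Qed.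

Lemma subpath_cts a s t : continuous a -> continuous (fun u => a (aff s t u)).
Proof. by move=> ca; apply: (cts_comp ca); exact: aff_cts. Qed.

(** Both sides are [a] composed with a real function from [s] to [r], one of them passing through
    [t]. No order among [s], [t], [r] is assumed. *)
Lemma subpath_split a s t r : continuous a ->
  homot (fun u => a (aff s r u))
        (pcat (fun u => a (aff s t u)) (fun u => a (aff t r u))).
Proof.
move=> ca.
apply: (@homot_trans (fun u => a (if u <= 2^-1 then aff s t (2 * u) else aff t r (2 * u - 1)))).
  apply: (homot_reparam (g := fun u =>
    if u <= 2^-1 then aff s t (2 * u) else aff t r (2 * u - 1))) => //.
  - exact: aff_cts.
  - apply: (@cts_if R R R id 2^-1 (fun u => aff s t (2 * u)) (fun u => aff t r (2 * u - 1))).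
    + exact: cts_id.
    + by rewrite /aff; cts.
    + by rewrite /aff; cts.
    + by move=> u ->; rewrite divff ?subrr ?pnatr_eq0 // aff0 aff1.
  - by rewrite invr_ge0 ler0n mulr0 !aff0.
  - have -> : (1 <= 2^-1 :> R) = false by apply/negbTE; rewrite half_le01; lra.
    by rewrite aff1 /aff; ring.
apply: homot_sym; apply: homot_eq; last by move=> u _; rewrite /pcat; case: ifP.
by apply: pcat_cts; [exact: subpath_cts|exact: subpath_cts|rewrite aff0 aff1].
Qed.

(* A homotopy from [a] to [b] dragging the endpoints along [d] and [d'] is the
   same thing as a homotopy rel endpoints from [d^-1 a d'] to [b]. *)
Lemma square_fill a b d d' : continuous a -> continuous d -> continuous d' ->
  d 0 = a 0 -> d' 0 = a 1 -> homot (pcat (path_inv d) (pcat a d')) b ->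
  exists H : R * R -> G, [/\ continuous H,
    forall t, 0 <= t <= 1 -> H (t, 0) = a t /\ H (t, 1) = b t &
    forall s, 0 <= s -> H (0, s) = d (Num.min (2 * s) 1) /\
                        H (1, s) = d' (Num.min (2 * s) 1)].
Proof.
move=> ca cd cd' da d'a [K [cK k r]].
pose l := pcat (path_inv d) (pcat a d').
have cl : continuous l.
  apply: pcat_cts; [exact: path_inv_cts|exact: pcat_cts|by rewrite pcat0 /path_inv subrr].
(* In [l] the path [a] occupies [1/2, 3/4]. At height [s] the map [Q] runs through [l] from
   [(1 - s) / 2] to [3 / 4 + s / 4]: it is [a] at the bottom and all of [l] at the top, and its
   sides trace [d] and [d']. *)
pose Q (z : R * R) := l ((1 - z.1) * ((1 - z.2) / 2) + z.1 * (3 / 4 + z.2 / 4)).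
have cQ : continuous Q.
  apply: (cts_comp cl (f := fun z : R * R =>
    (1 - z.1) * ((1 - z.2) / 2) + z.1 * (3 / 4 + z.2 / 4))).
  by cts.
have Q0 t : 0 <= t <= 1 -> Q (t, 0) = a t.
  move=> /andP[t0 t1]; rewrite /Q /l /pcat /= half_le01; case: ifP => h.
    have -> : t = 0 by lra.
    by rewrite /path_inv -da; congr d; lra.
  have -> : 2 * ((1 - t) * ((1 - 0) * (1 / 2)) + t * (3 / 4 + 0 / 4)) - 1 <= 1 / 2 by lra.
  by congr a; lra.
have Q1 t : Q (t, 1) = l t by rewrite /Q /=; congr l; lra.
have Qd s : 0 <= s <= 1 -> Q (0, s) = d s.
  move=> /andP[s0 s1]; rewrite /Q /l /pcat /= half_le01.
  have -> : (1 - 0) * ((1 - s) * (1 / 2)) + 0 * (3 / 4 + s / 4) <= 1 / 2 by lra.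
  by rewrite /path_inv; congr d; lra.
have Qd' s : 0 <= s <= 1 -> Q (1, s) = d' s.
  move=> /andP[s0 s1]; rewrite /Q /l /pcat /= half_le01.
  have -> : ((1 - 1) * ((1 - s) * (1 / 2)) + 1 * (3 / 4 + s / 4) <= 1 / 2) = false.
    by apply/negbTE; lra.
  case: ifP => h; last by congr d'; lra.
  have -> : s = 0 by lra.
  by rewrite d'a; congr a; lra.
exists (fun z => if z.2 <= 2^-1 then Q (clamp z.1, 2 * z.2)
  else K (clamp z.1, 2 * z.2 - 1)); split=> [|t t01|s s0] /=.
- apply: (@cts_if R _ _ snd 2^-1 (fun z => Q (clamp z.1, 2 * z.2))
     (fun z => K (clamp z.1, 2 * z.2 - 1))).
  + exact: cts_snd.
  + apply: (cts_comp cQ (f := fun z : R * R => (clamp z.1, 2 * z.2))).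
    by apply: cts_pair; [apply: clamp_cts|]; cts.
  + apply: (cts_comp cK (f := fun z : R * R => (clamp z.1, 2 * z.2 - 1))).
    by apply: cts_pair; [apply: clamp_cts|]; cts.
  + move=> z ->; rewrite divff ?pnatr_eq0 // subrr.
    by rewrite Q1; have [-> _] := k _ (clamp_itv z.1).
- rewrite invr_ge0 ler0n mulr0 clamp_id //; rewrite Q0 //.
  have -> : (1 <= 2^-1 :> R) = false by apply/negbTE; rewrite half_le01; lra.
  by rewrite (_ : 2 * 1 - 1 = 1 :> R); [have [_ ->] := k _ t01|ring].
- rewrite clamp0 clamp1 half_le01; case: ifP => h.
    by rewrite min_l ?Qd ?Qd' //; lra.
  rewrite min_r; last by lra.
  have [-> ->] := r (2 * s - 1).
  by rewrite pcat0 /path_inv subr0 !pcat1.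
Qed.

End PathHomotopy.

(** * Realisations of simple graphs *)

Section Simplicial.
Variables (R : realType) (G : topologicalType) (S : finType) (adj : rel S).

Definition supp (u : S -> R) (a b : S) := forall c, c != a -> c != b -> u c = 0.

Definition in_realisation (u : S -> R) := [/\ forall a, 0 <= u a,
  \sum_a u a = 1 & exists a b, estep adj a b /\ supp u a b].

(* G is the geometric realisation of the simple graph [adj]: [coord x] lists the
   barycentric coordinates of x and [mk] inverts it (with junk values outside the
   realisation). *)
Record smodel (coord : G -> S -> R) (mk : (S -> R) -> G) : Prop := SModel {
  sm_sym : symmetric adj;
  sm_irr : irreflexive adj;
  sm_cts : forall a, continuous (fun x => coord x a);
  sm_inj : forall x y, (forall a, coord x a = coord y a) -> x = y;
  sm_real : forall x, in_realisation (coord x);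
  sm_mk : forall u, in_realisation u -> forall a, coord (mk u) a = u a;
  sm_compact : compact [set: G]
}.

Arguments sm_cts {coord mk} _ a.

Variables (coord : G -> S -> R) (mk : (S -> R) -> G).
Hypothesis sm : smodel coord mk.

(** Outside an open neighbourhood of [f x] there remains a compact set, each point of which is told
    apart from [f x] by a coordinate. Compactness turns this into one neighbourhood of [x]. *)
Lemma cts_into (X : topologicalType) (f : X -> G) :
  (forall a, continuous (fun x => coord (f x) a)) -> continuous f.
Proof.
move=> cf x U; rewrite nbhsE => -[O [oO Ofx] OU].
have cK : compact (~` O).
  by apply: subclosed_compact (sm_compact sm) _ => //; exact: open_closedC.
move/compact_near_coveringP: cK => cK.
suff h : \forall z \near nbhs x, (~` O) `<=` (fun y => f z <> y).
  apply: filterS h => z hz; apply: OU; apply: contrapT => nO.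
  exact: (hz (f z) nO).
apply: cK => y nOy.
have [a fya] : exists a, coord (f x) a <> coord y a.
  apply: contrapT => h; apply: nOy; suff <- : f x = y by [].
  apply: (sm_inj sm) => a; apply: contrapT => ha; apply: h; by exists a.
have : open [set z : G * X | coord (f z.2) a != coord z.1 a].
  have -> : [set z : G * X | coord (f z.2) a != coord z.1 a] =
     [set z : G * X | 0 < `|coord (f z.2) a - coord z.1 a|].
    by apply/seteqP; split=> z /=; rewrite normr_gt0 subr_eq0.
  apply: open_lt_cts; first exact: cst_continuous.
  apply: cts_norm; apply: cts_add; first exact: cts_comp (cf a) (@cts_snd G X).
  by apply: cts_opp; exact: cts_comp (sm_cts sm a) (@cts_fst G X).
move=> op; have : nbhs (y, x) [set z : G * X | coord (f z.2) a != coord z.1 a].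
  by apply: open_nbhs_nbhs; split=> //=; exact/eqP.
by apply: filterS => z /= /eqP h fz; apply: h; rewrite fz.
Qed.

(** A common closed edge (or vertex) contains both points. This is the condition under which the
    convex combinations [lin x y s] stay in the realisation. *)
Definition simple (x y : G) := exists a b,
  [/\ estep adj a b, supp (coord x) a b & supp (coord y) a b].

Definition lin (x y : G) (s : R) : G :=
  mk (fun a => (1 - s) * coord x a + s * coord y a).

Lemma coord_lin x y s a : simple x y -> 0 <= s <= 1 ->
  coord (lin x y s) a = (1 - s) * coord x a + s * coord y a.
Proof.
move=> [b [c [bc sx sy]]] /andP[s0 s1]; rewrite /lin (sm_mk sm) //.
have [x0 x1 _] := sm_real sm x; have [y0 y1 _] := sm_real sm y.
split=> [d||]; last by exists b, c; split=> // d db dc; rewrite sx // sy // !mulr0 addr0.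
  by rewrite addr_ge0 // mulr_ge0 // subr_ge0.
by rewrite big_split /= -!mulr_sumr x1 y1 !mulr1 subrK.
Qed.

Lemma lin_at0 x y : simple x y -> lin x y 0 = x.
Proof.
move=> xy; apply: (sm_inj sm) => a.
by rewrite coord_lin ?lexx ?ler01 // subr0 mul1r mul0r addr0.
Qed.

Lemma lin_at1 x y : simple x y -> lin x y 1 = y.
Proof.
move=> xy; apply: (sm_inj sm) => a.
by rewrite coord_lin ?lexx ?ler01 // subrr mul1r mul0r add0r.
Qed.

Lemma simple_refl x : simple x x.
Proof. by have [_ _ [a [b [ab h]]]] := sm_real sm x; exists a, b. Qed.

Lemma lin_same x s : 0 <= s <= 1 -> lin x x s = x.
Proof.
move=> s01; apply: (sm_inj sm) => a.
by rewrite coord_lin //; [rewrite -mulrDl subrK mul1r|exact: simple_refl].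
Qed.

Lemma lin_cts (X : topologicalType) (f g : X -> G) (s : X -> R) :
  continuous f -> continuous g -> continuous s ->
  (forall z, simple (f z) (g z)) -> (forall z, 0 <= s z <= 1) ->
  continuous (fun z => lin (f z) (g z) (s z)).
Proof.
move=> cf cg cs fg s01; apply: cts_into => a.
have -> : (fun z => coord (lin (f z) (g z) (s z)) a) =
    (fun z => (1 - s z) * coord (f z) a + s z * coord (g z) a).
  by apply/funext => z; rewrite coord_lin.
by cts; [exact: cts_comp (sm_cts sm a) cf|exact: cts_comp (sm_cts sm a) cg].
Qed.

Definition vert (a : S) : G := mk (fun b => (a == b)%:R).

Lemma coord_vert a b : coord (vert a) b = (a == b)%:R.
Proof.
rewrite /vert (sm_mk sm) //; split=> [c||]; first exact: ler0n.
  by rewrite (bigD1 a) //= eqxx big1 ?addr0 // => c; rewrite eq_sym => /negPf ->.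
by exists a, a; split=> [|c ca _]; [rewrite /estep eqxx|rewrite eq_sym (negPf ca)].
Qed.

Lemma supp_vert a b : supp (coord (vert a)) a b.
Proof. by move=> c ca _; rewrite coord_vert eq_sym (negPf ca). Qed.

Lemma estep_sym a b : estep adj a b = estep adj b a.
Proof. by rewrite /estep eq_sym (sm_sym sm). Qed.

Lemma supp_sym u a b : supp u a b -> supp u b a.
Proof. by move=> h c cb ca; apply: h. Qed.

(** Here and below, [0 < coord x a] expresses that [x] lies in the open star of [a]. *)
Lemma star_edge x a : 0 < coord x a -> exists2 b, estep adj a b & supp (coord x) a b.
Proof.
move=> xa; have [_ _ [c [d [cd h]]]] := sm_real sm x.
have [ac|ac] := eqVneq a c; first by subst c; exists d.
have [ad|ad] := eqVneq a d.
  by subst d; exists c; [rewrite estep_sym|exact: supp_sym].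
by move: xa; rewrite h // ltxx.
Qed.

Lemma star_simple x a : 0 < coord x a -> simple x (vert a).
Proof.
by move=> /star_edge[b ab h]; exists a, b; split=> //; exact: supp_vert.
Qed.

Lemma star_exists x : exists a, 0 < coord x a.
Proof.
have [x0 x1 _] := sm_real sm x; apply: contrapT => h.
suff : \sum_a coord x a = 0 by rewrite x1 => /eqP; rewrite oner_eq0.
apply: big1 => a _; apply/eqP; rewrite eq_le x0 andbT leNgt.
by apply/negP => xa; apply: h; exists a.
Qed.

Lemma star_vert a b : 0 < coord (vert a) b -> a = b.
Proof. by rewrite coord_vert; case: eqP => // _; rewrite ltxx. Qed.

Lemma supp_pos x c d a : supp (coord x) c d -> 0 < coord x a -> a = c \/ a = d.
Proof.
move=> h xa; have [->|ac] := eqVneq a c; first by left.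
have [->|ad] := eqVneq a d; first by right.
by move: xa; rewrite h // ltxx.
Qed.

Lemma star_star x a b : 0 < coord x a -> 0 < coord x b ->
  estep adj a b /\ exists c d, [/\ estep adj c d, supp (coord x) c d,
    supp (coord (vert a)) c d & supp (coord (vert b)) c d].
Proof.
move=> xa xb; have [_ _ [c [d [cd h]]]] := sm_real sm x.
have sv e : 0 < coord x e -> supp (coord (vert e)) c d.
  by move=> /(supp_pos h)[->|->]; [|apply: supp_sym]; exact: supp_vert.
split; last by exists c, d; split=> //; exact: sv.
have [->|ab] := eqVneq a b; first by rewrite /estep eqxx.
case: (supp_pos h xa) (supp_pos h xb) => aE [] bE; move: ab; rewrite aE bE ?eqxx //.
by rewrite estep_sym.
Qed.

Definition seg (x y : G) (t : R) : G := lin x y (clamp t).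

Lemma seg_cts x y : simple x y -> continuous (seg x y).
Proof.
move=> xy; apply: lin_cts => //; try exact: cst_continuous.
  by apply: clamp_cts; exact: cts_id.
by move=> z; exact: clamp_itv.
Qed.

Lemma seg0 x y : simple x y -> seg x y 0 = x.
Proof. by move=> xy; rewrite /seg clamp0 lin_at0. Qed.

Lemma seg1 x y : simple x y -> seg x y 1 = y.
Proof. by move=> xy; rewrite /seg clamp1 lin_at1. Qed.

Lemma seg_same x t : seg x x t = x.
Proof. by rewrite /seg lin_same // clamp_itv. Qed.

Lemma supp_seg x y a b t : estep adj a b -> supp (coord x) a b ->
  supp (coord y) a b -> supp (coord (seg x y t)) a b.
Proof.
move=> ab sx sy c ca cb; rewrite /seg coord_lin ?clamp_itv //; last by exists a, b.
by rewrite sx // sy // !mulr0 addr0.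
Qed.

(** The straight-line homotopy, which makes sense because the two points share a closed edge at
    every time. *)
Lemma homot_simple (f g : R -> G) : continuous f -> continuous g ->
  f 0 = g 0 -> f 1 = g 1 -> (forall t, 0 <= t <= 1 -> simple (f t) (g t)) ->
  homot f g.
Proof.
move=> cf cg e0 e1 fg.
exists (fun z => lin (f (clamp z.1)) (g (clamp z.1)) (clamp z.2)); split.
- have cc : continuous (fun z : R * R => clamp z.1) by apply: clamp_cts; exact: cts_fst.
  apply: lin_cts; [exact: cts_comp cf cc|exact: cts_comp cg cc| |by move=> z; apply/fg/clamp_itv|
    by move=> z; exact: clamp_itv].
  by apply: clamp_cts; exact: cts_snd.
- by move=> t t01 /=; rewrite clamp_id // clamp0 clamp1 lin_at0 ?lin_at1 //; exact: fg.
- by move=> s /=; rewrite clamp0 clamp1 -e0 -e1 !lin_same ?clamp_itv.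
Qed.

(** The first step takes half of the time, the second a quarter, and so on. The timetable depends
    only on the length of the list, so lists of equal length run in lockstep. *)
Fixpoint path_of (a : S) (l : seq S) : R -> G :=
  if l is b :: l' then pcat (seg (vert a) (vert b)) (path_of b l')
  else fun=> vert a.

Lemma estep_simple a b : estep adj a b -> simple (vert a) (vert b).
Proof. by move=> ab; exists a, b; split=> //; [|apply: supp_sym]; exact: supp_vert. Qed.

Lemma path_of0 a l : path (estep adj) a l -> path_of a l 0 = vert a.
Proof. by case: l => //= b l /andP[ab _]; rewrite pcat0 seg0 //; exact: estep_simple. Qed.

Lemma path_of1 a l : path_of a l 1 = vert (last a l).
Proof. by elim: l a => //= b l IHl a; rewrite pcat1. Qed.

Lemma path_of_cts a l : path (estep adj) a l -> continuous (path_of a l).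
Proof.
elim: l a => [|b l IHl] a /=; first by move=> _; exact: cst_continuous.
move=> /andP[ab pl]; have sab := estep_simple ab.
by apply: pcat_cts; [exact: seg_cts|exact: IHl|rewrite seg1 // path_of0].
Qed.

Lemma path_of_stay a l : path (estep adj) a l -> homot (path_of a (a :: l)) (path_of a l).
Proof.
move=> pl /=; have cl := path_of_cts pl.
apply: homot_trans (pcat1l cl).
have saa := estep_simple (_ : estep adj a a).
apply: homot_eq.
  by apply: pcat_cts => //; [apply/seg_cts/simple_refl|rewrite seg_same path_of0].
by move=> t _; rewrite /pcat seg_same path_of0.
Qed.

Lemma path_of_back a b l : path (estep adj) a l -> adj a b ->
  homot (path_of a [:: b, a & l]) (path_of a l).
Proof.
move=> pl ab /=; have cl := path_of_cts pl.
have eab : estep adj a b by rewrite /estep ab orbT.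
have sab := estep_simple eab.
have sba : simple (vert b) (vert a) by apply: estep_simple; rewrite estep_sym.
have cab := seg_cts sab; have cba := seg_cts sba.
apply: homot_trans (homot_sym (pcatA cab cba cl _ _)) _.
- by rewrite seg0 // seg1.
- by rewrite seg1 // path_of0.
apply: homot_trans (pcat1l cl); apply: homot_pcat; last 2 first.
- exact: homot_refl.
- by rewrite pcat1 seg1 // path_of0.
rewrite path_of0 //; apply: homot_simple; rewrite ?pcat0 ?pcat1 ?seg0 ?seg1 //.
- by apply: pcat_cts => //; rewrite seg0 // seg1.
- exact: cst_continuous.
move=> t _; exists a, b; split=> //; last exact: supp_vert.
by rewrite /pcat; case: ifP => _; apply: supp_seg => //;
  try exact: supp_vert; apply: supp_sym; exact: supp_vert.
Qed.

Definition path_of_seq (o : S) (l : seq S) := path_of (head o l) (behead l).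

(** The first three conjuncts carry the induction: transitivity needs the intermediate list to be a
    walk, and [lift] needs equal heads in order to put a common prefix in front. *)
Lemma weq_homot o l l' : weq adj l l' ->
  [/\ sorted (estep adj) l = sorted (estep adj) l', head o l = head o l',
      (l == [::]) = (l' == [::]) &
      sorted (estep adj) l -> homot (path_of_seq o l) (path_of_seq o l')].
Proof.
have lift p l1 l2 : l1 != [::] -> l2 != [::] -> head o l1 = head o l2 ->
   (sorted (estep adj) l1 = sorted (estep adj) l2) ->
   (sorted (estep adj) l1 -> homot (path_of_seq o l1) (path_of_seq o l2)) ->
   [/\ sorted (estep adj) (p ++ l1) = sorted (estep adj) (p ++ l2),
      head o (p ++ l1) = head o (p ++ l2),
      (p ++ l1 == [::]) = (p ++ l2 == [::]) &
      sorted (estep adj) (p ++ l1) -> homot (path_of_seq o (p ++ l1)) (path_of_seq o (p ++ l2))].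
  move=> n1 n2 h12 s12 hh; elim: p => [|x p [IHs IHh IHn IHp]] /=.
    by split=> //; rewrite (negPf n1) (negPf n2).
  have ne1 : p ++ l1 != [::] by case: p {IHs IHh IHn IHp}.
  have ne2 : p ++ l2 != [::] by case: p {IHs IHh IHn IHp ne1}.
  case: (p ++ l1) (p ++ l2) ne1 ne2 IHs IHh IHn IHp => [|y1 q1] [|y2 q2] //= _ _ IHs yE _.
  subst y2; move=> IHp; split=> //=; first by rewrite IHs.
  move=> /andP[xy pq]; rewrite /path_of_seq /=; apply: homot_pcat.
  - by apply/homot_refl/seg_cts/estep_simple.
  - exact: IHp.
  - by rewrite path_of0 // seg1 //; exact: estep_simple.
elim=> {l l'} [l|l l' _ [s h n p]|l l1 l2 _ [s h n p] _ [s' h' n' p']|p a q|p a b q ab].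
- split=> // sl; apply/homot_refl; rewrite /path_of_seq; case: l sl => [|x l] /= pl.
    exact: cst_continuous.
  exact: path_of_cts.
- by split=> //; rewrite -s => sl; apply/homot_sym/p.
- split; [by rewrite s|by rewrite h|by rewrite n|move=> sl].
  by apply: homot_trans (p sl) (p' _); rewrite -s.
- by apply: lift => //=; [rewrite /estep eqxx|move=> /andP[_]; exact: path_of_stay].
- apply: lift => //=; first by rewrite /estep ab (sm_sym sm) ab !orbT.
  by move=> /and3P[_ _ pq]; exact: path_of_back.
Qed.

End Simplicial.

Arguments sm_cts {R G S adj coord mk} _ a.

(** * Paths between vertices are homotopic to walks *)

Section WalkApproximation.
Variables (R : realType) (G : topologicalType) (S : finType) (adj : rel S).
Variables (coord : G -> S -> R) (mk : (S -> R) -> G).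
Hypothesis sm : smodel adj coord mk.
Local Notation sgm := (seg coord mk).
Local Notation vtx := (vert mk).
Local Notation wpath := (path_of coord mk).

(* The cone of a path inside the open star of [a] gives the homotopy. *)
Lemma star_contract (f : R -> G) a : continuous f ->
  (forall u, 0 <= u <= 1 -> 0 < coord (f u) a) ->
  homot (pcat f (sgm (f 1) (vtx a))) (sgm (f 0) (vtx a)).
Proof.
move=> cf fa; pose A u := f (clamp u).
have sA u : simple adj coord (A u) (vtx a).
  by apply: (star_simple sm); apply: fa; exact: clamp_itv.
have A0 : A 0 = f 0 by rewrite /A clamp0.
have A1 : A 1 = f 1 by rewrite /A clamp1.
have s0 : simple adj coord (f 0) (vtx a) by rewrite -A0.
have s1 : simple adj coord (f 1) (vtx a) by rewrite -A1.
pose Q (z : R * R) := lin coord mk (A z.1) (vtx a) (clamp z.2).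
have cQ : continuous Q.
  apply: (lin_cts sm) => //; last 2 first.
  - by apply: clamp_cts; exact: cts_snd.
  - by move=> z; exact: clamp_itv.
  - by apply: (cts_comp cf (f := fun z : R * R => clamp z.1)); apply: clamp_cts; exact: cts_fst.
  - exact: cst_continuous.
have cs0 := seg_cts sm s0; have cs1 := seg_cts sm s1.
(* In the square [Q], the bottom side followed by the right one is deformed into the left side
   followed by the top one; the top side is constant at the vertex. *)
apply: (@homot_trans _ _ (fun t => Q (Num.min (2 * t) 1, Num.max 0 (2 * t - 1)))).
  apply: homot_eq; first by apply: pcat_cts => //; rewrite (seg0 sm).
  move=> t /andP[t0 t1]; rewrite /pcat half_le01; case: ifP => h.
    rewrite min_l; last by lra.
    rewrite max_l; last by lra.
    by rewrite /Q /= clamp0 (lin_at0 sm) // /A clamp_id //; lra.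
  rewrite min_r; last by lra.
  rewrite max_r; last by lra.
  by rewrite /Q /= A1.
apply: (@homot_trans _ _ (fun t => Q (Num.max 0 (2 * t - 1), Num.min (2 * t) 1))).
  apply: homot_plane => //; try by cts.
  - by rewrite mulr0 min_l ?ler01 // max_l //; lra.
  - by rewrite mulr0 min_l ?ler01 // max_l //; lra.
  - by rewrite mulr1 min_r ?max_r; lra.
  - by rewrite mulr1 min_r ?max_r; lra.
apply: (homot_trans _ (pcat1r cs0)); apply: homot_sym; apply: homot_eq.
  by apply: pcat_cts => //; exact: cst_continuous.
move=> t /andP[t0 t1]; rewrite /pcat half_le01; case: ifP => h.
  rewrite min_l; last by lra.
  rewrite max_l; last by lra.
  by rewrite /Q /= A0.
rewrite min_r; last by lra.
rewrite max_r; last by lra.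
by rewrite /Q /= clamp1 (lin_at1 sm) // (seg1 sm).
Qed.

Lemma seg_two_stars x a b : 0 < coord x a -> 0 < coord x b ->
  homot (sgm x (vtx a)) (pcat (sgm x (vtx b)) (sgm (vtx b) (vtx a))).
Proof.
move=> xa xb; have [ab [c [d [cd sx sa sb]]]] := star_star sm xa xb.
have hxa := star_simple sm xa; have hxb := star_simple sm xb.
have hba : simple adj coord (vtx b) (vtx a) by exists c, d.
apply: (homot_simple sm); rewrite ?pcat0 ?pcat1 ?(seg0 sm) ?(seg1 sm) //.
- exact: (seg_cts sm).
- by apply: pcat_cts; [exact: (seg_cts sm)|exact: (seg_cts sm)|rewrite (seg0 sm) ?(seg1 sm)].
move=> t _; exists c, d; split=> //; first exact: (supp_seg sm).
by rewrite /pcat; case: ifP => _; exact: (supp_seg sm).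
Qed.

Section PathWalk.
Variables (f : R -> G) (e : S).
Hypotheses (cf : continuous f) (f1 : f 1 = vtx e).

(** Quantifying over every vertex [b] whose open star contains [f t] makes the property independent
    of a choice of star, so that it can pass between nearby parameters. *)
Definition tail_walk t := forall b, 0 < coord (f t) b -> exists P,
  [/\ path (estep adj) b P, last b P = e &
      homot (fun u => f (aff t 1 u)) (pcat (sgm (f t) (vtx b)) (wpath b P))].

(** The piece of [f] from [t] to [s] stays in the star of [a] and contracts there, which puts [a] in
    front of the walk. As [t] may lie on either side of [s], this gives both directions of local
    constancy. *)
Lemma tail_walk_step a t s : (forall u, 0 <= u <= 1 -> 0 < coord (f (aff t s u)) a) ->
  tail_walk s -> tail_walk t.
Proof.
move=> fa Ts b tb.
have ta : 0 < coord (f t) a by rewrite -(aff0 t s); apply: fa; rewrite lexx ler01.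
have sa : 0 < coord (f s) a by rewrite -(aff1 t s); apply: fa; rewrite lexx ler01.
have [P [pP lP hP]] := Ts a sa.
have [ab _] := star_star sm tb ta.
have hta := star_simple sm ta; have htb := star_simple sm tb.
have hsa := star_simple sm sa; have hba := estep_simple sm ab.
have cP := path_of_cts sm pP.
have cts_ := @subpath_cts _ _ _ t s cf.
have csa := seg_cts sm hsa; have cta := seg_cts sm hta.
have ctb := seg_cts sm htb; have cba := seg_cts sm hba.
exists (a :: P); split=> //=; first by rewrite ab.
apply: homot_trans (@subpath_split _ _ _ t s 1 cf) _.
apply: homot_trans (homot_pcat (homot_refl cts_) hP _) _; first by rewrite aff0 aff1.
apply: homot_trans (homot_sym (pcatA cts_ csa cP _ _)) _.
- by rewrite aff1 (seg0 sm).
- by rewrite (seg1 sm) // (path_of0 sm).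
have h1 := star_contract cts_ fa; rewrite /= aff0 aff1 in h1.
have h2 := seg_two_stars ta tb.
apply: homot_trans (homot_pcat (homot_trans h1 h2) (homot_refl cP) _) _.
  by rewrite pcat1 (seg1 sm) // (path_of0 sm).
apply: pcatA => //; first by rewrite (seg1 sm) // (seg0 sm).
by rewrite (seg1 sm) // (path_of0 sm).
Qed.

Lemma tail_walk1 : tail_walk 1.
Proof.
move=> b; rewrite f1 => /(star_vert sm) <-; exists [::]; split=> //=.
apply: homot_eq; first exact: subpath_cts.
move=> t _; rewrite (_ : aff 1 1 t = 1); last by rewrite /aff; ring.
by rewrite f1 /pcat (seg_same sm); case: ifP.
Qed.

(** Connectedness of the line replaces a subdivision of [0, 1] into pieces lying in single stars:
    the property holds at 1 and is locally constant. *)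
Lemma tail_walk0 : tail_walk 0.
Proof.
rewrite -clamp0.
apply: (@connected_locally_constant R setT (fun t => tail_walk (clamp t)) _ _ 1) => //.
- by apply/connected_intervalP.
- move=> t0 _.
  have [a fa] := star_exists sm (f (clamp t0)).
  have : \forall y \near clamp t0, 0 < coord (f y) a.
    apply: open_nbhs_nbhs; split=> //.
    apply: open_lt_cts; first exact: cst_continuous.
    exact: cts_comp (sm_cts sm a) cf.
  move=> /nbhs_ballP[r /= r0 ball_r].
  have cc : continuous (fun t : R => clamp t) by apply: clamp_cts; exact: cts_id.
  have cb : \forall t \near t0, ball (clamp t0) r (clamp t).
    by apply: cc; exact: nbhsx_ballx.
  apply: filterS cb => t tr _.
  have near_a y : `|y - clamp t0| < r -> 0 < coord (f y) a.
    by move=> yr; apply: ball_r; rewrite -ball_normE /= distrC.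
  move: tr; rewrite -ball_normE /= distrC => tr.
  split; apply: (@tail_walk_step a) => u /andP[u0 u1]; apply: near_a; rewrite /aff.
    rewrite (_ : _ - _ = (1 - u) * (clamp t - clamp t0)); last by ring.
    rewrite normrM ger0_norm ?subr_ge0 //; apply: le_lt_trans tr.
    by rewrite -[leRHS]mul1r ler_wpM2r //; lra.
  rewrite (_ : _ - _ = u * (clamp t - clamp t0)); last by ring.
  rewrite normrM ger0_norm //; apply: le_lt_trans tr.
  by rewrite -[leRHS]mul1r ler_wpM2r //; lra.
- by rewrite clamp1; exact: tail_walk1.
Qed.

End PathWalk.

Theorem path_walk (f : R -> G) a b : continuous f -> f 0 = vtx a -> f 1 = vtx b ->
  exists P, [/\ path (estep adj) a P, last a P = b & homot f (wpath a P)].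
Proof.
move=> cf f0 f1; have [|P [pP lP hP]] := @tail_walk0 f b cf f1 a.
  by rewrite f0 (coord_vert sm) eqxx ltr01.
exists P; split=> //; apply: homot_trans (homot_trans hP _).
  by apply: homot_eq => // t _; congr f; rewrite /aff; ring.
have cP := path_of_cts sm pP; apply: homot_trans (pcat1l cP).
rewrite (path_of0 sm) // f0; apply: homot_eq.
  apply: pcat_cts => //; first exact/(seg_cts sm)/(simple_refl sm).
  by rewrite (seg_same sm) (path_of0 sm).
by move=> t _; rewrite /pcat (seg_same sm).
Qed.

End WalkApproximation.

(** * Subdivision *)

Lemma aff_oo (R : realType) (l r t : R) : l < r -> 0 < t < 1 -> l < aff l r t < r.
Proof. by move=> lr /andP[t0 t1]; rewrite /aff; nra. Qed.

Lemma aff_inv (R : realType) (l r s : R) : l < r -> l < s < r ->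
  exists2 t, 0 < t < 1 & aff l r t = s.
Proof.
move=> lr /andP[ls sr]; have d0 : 0 < r - l by rewrite subr_gt0.
exists ((s - l) / (r - l)).
  by rewrite divr_gt0 ?subr_gt0 // ltr_pdivrMr // mul1r ltrD2r.
by rewrite /aff; field; rewrite gt_eqF.
Qed.

Lemma aff_inj (R : realType) (l r s t : R) : l < r -> aff l r s = aff l r t -> s = t.
Proof.
move=> lr /eqP; rewrite -subr_eq0 /aff.
have -> : (1 - s) * l + s * r - ((1 - t) * l + t * r) = (s - t) * (r - l) by ring.
by rewrite mulf_eq0 !subr_eq0 (gt_eqF lr) orbF => /eqP.
Qed.

Section Subdivision.
Variables (R : realType) (X : topologicalType) (V E : finType).
Variables (v : V -> X) (c : E -> R -> X).
Hypothesis gr : cgraph v c.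

(** The edge [e] of the new structure is the part of the old edge [p e] between [l e] and [r e]. The
    hypotheses say that these intervals tile every old edge, with the new vertices as the cutting
    points. *)
Lemma cgraph_subdivide (V' E' : finType) (v' : V' -> X) (p : E' -> E) (l r : E' -> R) :
  injective v' -> (forall u, exists u', v u = v' u') ->
  (forall e, [/\ 0 <= l e, l e < r e & r e <= 1]) ->
  (forall e, (exists u, c (p e) (l e) = v' u) /\ (exists u, c (p e) (r e) = v' u)) ->
  (forall e t u, l e < t < r e -> c (p e) t <> v' u) ->
  (forall e1 e2 t, p e1 = p e2 -> l e1 < t < r e1 -> l e2 < t < r e2 -> e1 = e2) ->
  (forall e t, 0 < t < 1 -> (exists u, c e t = v' u) \/
     exists e', p e' = e /\ l e' < t < r e') ->
  cgraph v' (fun e t => c (p e) (aff (l e) (r e) t)).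
Proof.
move=> iv' vv' lr ends int disj cov.
have oo e t : 0 < t < 1 -> l e < aff (l e) (r e) t < r e.
  by have [_ h _] := lr e; exact: aff_oo.
have oo01 e t : l e < t < r e -> 0 < t < 1.
  by have [l0 _ r1] := lr e => /andP[lt tr]; rewrite (le_lt_trans l0 lt) (lt_le_trans tr r1).
split=> //.
- by move=> e; apply: (cts_comp (cg_cts gr (p e))); exact: aff_cts.
- by move=> e [] /=; rewrite ?aff0 ?aff1; have [] := ends e.
- by move=> e t u t01; apply: int; exact: oo.
- move=> e1 e2 t1 t2 /oo o1 /oo o2 h.
  have [pe st] := cg_int_inj gr (oo01 _ _ (o1 e1)) (oo01 _ _ (o2 e2)) h.
  have e12 : e1 = e2 by apply: (disj _ _ _ pe (o1 e1)); rewrite st.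
  by subst e2; split=> //; have [_ lre _] := lr e1; exact: aff_inj st.
- move=> x; case: (cg_cover gr x) => [[u ->]|[e [t [t01 ->]]]].
    by left; exact: vv'.
  case: (cov e t t01) => [|[e' [<- tlr]]]; first by left.
  right; have [_ lre _] := lr e'; have [s s01 <-] := aff_inv lre tlr.
  by exists e', s.
- exact: (cg_hausdorff gr).
Qed.

Lemma add_vertex (x : X) : exists (V' E' : finType) (v' : V' -> X) (c' : E' -> R -> X),
  cgraph v' c' /\ (forall y, (exists u, y = v' u) <-> (exists u, y = v u) \/ y = x).
Proof.
case: (cg_cover gr x) => [[u0 xu]|[e0 [s0 [s01 xE]]]].
  exists V, E, v, c; split=> // y; split=> [|[//|->]]; [by left|by exists u0].
have /andP[s0p s01'] := s01.
(* The edge [e0] is cut at [s0]: [Some e0] keeps the part before [x], and [None] is the part after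
   it. *)
pose v' (u : option V) := if u is Some u' then v u' else x.
pose p (e : option E) := if e is Some e' then e' else e0.
pose l (e : option E) := if e is Some e' then 0 else s0.
pose r (e : option E) := if e is Some e' then (if e' == e0 then s0 else 1) else 1.
exists (option V), (option E), v', (fun e t => c (p e) (aff (l e) (r e) t)); split; last first.
  move=> y; split=> [[[u|] ->]|[[u ->]|->]];
    [by left; exists u|by right|by exists (Some u)|by exists None].
have xv u : x <> v u by rewrite xE; exact: (cg_int gr s01).
have vend e b : exists u, c e (bnd b) = v' u.
  by have [u ->] := cg_end gr e b; exists (Some u).
apply: cgraph_subdivide.
- move=> [u1|] [u2|] //= h; first by congr Some; exact: (cg_inj gr).
  + by case: (xv u1).
  + by case: (xv u2).
- by move=> u; exists (Some u).
- by move=> [e|] /=; [case: eqP => _|]; split=> //; rewrite ?lexx ?ler01 ?ltr01 // ltW.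
- move=> [e|] /=; (split; last try exact: (vend _ true)).
  + exact: (vend e false).
  + by case: eqP => [->|_]; [exists None|exact: (vend e true)].
  + by exists None.
- move=> [e|] t [u|] /=.
  + case: eqP => [_|_] t01; apply: (cg_int gr) => //.
    by move: t01 => /andP[-> /lt_trans]; exact.
  + rewrite xE; case: eqP => [->|ne] /andP[t0 t1] h.
      have [|_ ts] := cg_int_inj gr _ s01 h; first by rewrite t0 (lt_trans t1).
      by move: t1; rewrite ts ltxx.
    by have [|ee _] := cg_int_inj gr _ s01 h; [rewrite t0|case: ne].
  + by move=> /andP[st t1]; apply: (cg_int gr); rewrite t1 (lt_trans s0p).
  + rewrite xE => /andP[st t1] h.
    have [|_ ts] := cg_int_inj gr _ s01 h; first by rewrite t1 (lt_trans s0p).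
    by move: st; rewrite ts ltxx.
- move=> [e1|] [e2|] t /= pe => [_ _|||//].
  + by rewrite pe.
  + by subst e1; rewrite eqxx => /andP[_ ts] /andP[st _]; have := lt_trans ts st; rewrite ltxx.
  + by subst e2; rewrite eqxx => /andP[st _] /andP[_ ts]; have := lt_trans ts st; rewrite ltxx.
- move=> e t /andP[t0 t1]; have [ee|ne] := eqVneq e e0; last first.
    by right; exists (Some e); rewrite /= (negPf ne) t0 t1.
  subst e; case: (ltgtP t s0) => ts.
  + by right; exists (Some e0); rewrite /= eqxx t0 ts.
  + by right; exists None; rewrite /= ts t1.
  + by left; exists None; rewrite /= xE ts.
Qed.

(* Every edge e is cut at [p e < q e] into the pieces [(e, Some false)],
   [(e, None)], [(e, Some true)], in this order. *)
Definition cut_vertex (p q : E -> R) (u : V + E * bool) : X :=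
  match u with
  | inl u' => v u'
  | inr (e, b) => c e (if b then q e else p e)
  end.

Definition cut_left (p q : E -> R) (e : E * option bool) : R :=
  match e.2 with Some false => 0 | None => p e.1 | Some true => q e.1 end.

Definition cut_right (p q : E -> R) (e : E * option bool) : R :=
  match e.2 with Some false => p e.1 | None => q e.1 | Some true => 1 end.

Definition cut_edge (p q : E -> R) (e : E * option bool) (t : R) : X :=
  c e.1 (aff (cut_left p q e) (cut_right p q e) t).

Lemma cut_cgraph (p q : E -> R) : (forall e, [/\ 0 < p e, p e < q e & q e < 1]) ->
  cgraph (cut_vertex p q) (cut_edge p q).
Proof.
move=> pq.
have pqb e (b : bool) : 0 < (if b then q e else p e) < 1.
  by have [h1 h2 h3] := pq e; case: b; apply/andP; split=> //; lra.
apply: cgraph_subdivide.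
- move=> [u1|[e1 b1]] [u2|[e2 b2]] /=.
  + by move=> /(cg_inj gr) ->.
  + by move=> /esym /(cg_int gr (pqb _ _)).
  + by move=> /(cg_int gr (pqb _ _)).
  + move=> /(cg_int_inj gr (pqb _ _) (pqb _ _))[ee h]; subst e2.
    congr (inr (_, _)); have [_ h2 _] := pq e1.
    by case: b1 b2 h => [] [] // h; move: h2; rewrite h ltxx.
- by move=> u; exists (inl u).
- by move=> [e [[]|]]; have [h1 h2 h3] := pq e; rewrite /cut_left /cut_right /=; split=> //; lra.
- move=> [e o]; have [h1 h2 h3] := pq e; rewrite /cut_left /cut_right /=.
  have e0 : exists u, c e 0 = cut_vertex p q u.
    by have [u ->] := cg_end gr e false; exists (inl u).
  have e1 : exists u, c e 1 = cut_vertex p q u.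
    by have [u ->] := cg_end gr e true; exists (inl u).
  by case: o => [[]|]; split=> //; [exists (inr (e, true))|exists (inr (e, false))
    |exists (inr (e, false))|exists (inr (e, true))].
- move=> [e o] t u tlr.
  have [h1 h2 h3] := pq e.
  have t01 : 0 < t < 1.
    move: tlr; rewrite /cut_left /cut_right.
    by case: o => [[]|] /= /andP[? ?]; apply/andP; split; lra.
  case: u => [u|[e' b]] /=; first exact: (cg_int gr).
  move=> /(cg_int_inj gr t01 (pqb _ _))[ee tE]; subst e' t.
  by move: tlr; rewrite /cut_left /cut_right; case: o b {t01} => [[]|] [] /= /andP[? ?]; lra.
- move=> [e1 o1] [e2 o2] t /= e12; subst e2; have [h1 h2 h3] := pq e1.
  rewrite /cut_left /cut_right /=.
  by case: o1 o2 => [[]|] [[]|] //= /andP[? ?] /andP[? ?]; exfalso; lra.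
- move=> e t /andP[t0 t1]; case: (ltgtP t (p e)) => tp.
  + by right; exists (e, Some false); rewrite /cut_left /cut_right /= t0 tp.
  + case: (ltgtP t (q e)) => tq.
    * by right; exists (e, None); rewrite /cut_left /cut_right /= tq tp.
    * by right; exists (e, Some true); rewrite /cut_left /cut_right /= tq t1.
    * by left; exists (inr (e, true)); rewrite tq.
  + by left; exists (inr (e, false)); rewrite tp.
Qed.

End Subdivision.

Lemma add_vertices (R : realType) (X : topologicalType) (V E : finType)
    (v : V -> X) (c : E -> R -> X) (s : seq X) : cgraph v c ->
  exists (V' E' : finType) (v' : V' -> X) (c' : E' -> R -> X),
  cgraph v' c' /\ (forall y, (exists u, y = v' u) <->
    (exists u, y = v u) \/ exists i, (i < size s)%N /\ nth y s i = y).
Proof.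
elim: s V E v c => [|x s IHs] V E v c gr.
  exists V, E, v, c; split=> // y; split=> [|[//|[i []//]]]; by left.
have [V1 [E1 [v1 [c1 [gr1 h1]]]]] := add_vertex gr x.
have [V2 [E2 [v2 [c2 [gr2 h2]]]]] := IHs _ _ _ _ gr1.
exists V2, E2, v2, c2; split=> // y; split.
  move=> /h2[/h1[|->]|[i [si yi]]]; [by left|by right; exists 0%N|].
  by right; exists i.+1.
case=> [yv|[[|i] [/= si yi]]]; apply/h2; [by left; apply/h1; left| |].
  by left; apply/h1; right.
by right; exists i.
Qed.

(** * Barycentric coordinates from a cell structure without loops and multiple edges *)

Section SimpleGraph.
Variables (R : realType) (X : topologicalType) (V E : finType).
Variables (v : V -> X) (c : E -> R -> X) (st : E -> bool -> V) (x0 : X).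
Hypotheses (gr : cgraph v c) (cst : forall e b, c e (bnd b) = v (st e b)).
Hypothesis loopless : forall e, st e false != st e true.
Hypothesis simple_edges : forall e e' b,
  st e false = st e' b -> st e true = st e' (~~ b) -> e = e'.

Definition end_adj : rel V := fun a b =>
  [exists e, [exists o, (st e o == a) && (st e (~~ o) == b)]].

Lemma end_adjP a b :
  reflect (exists e o, st e o = a /\ st e (~~ o) = b) (end_adj a b).
Proof.
apply: (iffP existsP) => [[e /existsP[o /andP[/eqP ea /eqP eb]]]|[e [o [ea eb]]]].
  by exists e, o.
by exists e; apply/existsP; exists o; rewrite ea eb !eqxx.
Qed.

Definition bary (e : E) (t : R) (a : V) : R :=
  (1 - t) * (st e false == a)%:R + t * (st e true == a)%:R.

Lemma bary_false e t : bary e t (st e false) = 1 - t.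
Proof. by rewrite /bary eqxx eq_sym (negPf (loopless e)) mulr0 addr0 mulr1. Qed.

Lemma bary_true e t : bary e t (st e true) = t.
Proof. by rewrite /bary eqxx (negPf (loopless e)) mulr0 add0r mulr1. Qed.

Lemma bary_other e t a : a != st e false -> a != st e true -> bary e t a = 0.
Proof.
by move=> af at_; rewrite /bary !(eq_sym _ a) (negPf af) (negPf at_) !mulr0 addr0.
Qed.

Lemma barycentric_coordinates : exists coord : X -> V -> R,
  [/\ forall a, continuous (fun x => coord x a),
      forall u a, coord (v u) a = (u == a)%:R &
      forall e t a, 0 <= t <= 1 -> coord (c e t) a = bary e t a].
Proof.
have /choice[g gP] : forall a, exists g : X -> R, [/\ continuous g,
    forall u, g (v u) = (u == a)%:R &
    forall e t, 0 <= t <= 1 -> g (c e t) = bary e t a].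
  move=> a; apply: (@cell_glue1 R X V E v c gr R (fun u => (u == a)%:R)
    (fun e t => bary e t a)) => [e|e b u]; first by rewrite /bary; cts.
  rewrite cst => /(cg_inj gr) <-; rewrite /bary.
  by case: b; rewrite /= ?(subrr, subr0) !(mul0r, mul1r) ?addr0 ?add0r.
exists (fun x a => g a x); split=> [a|u a|e t a]; have [g1 g2 g3] := gP a.
- exact: g1.
- exact: g2.
- exact: g3.
Qed.

Lemma simple_smodel : exists (coord : X -> V -> R) mk,
  smodel end_adj coord mk /\ forall a, vert mk a = v a.
Proof.
have [coord [ccts cv ce]] := barycentric_coordinates.
have oo_cc (t : R) : 0 < t < 1 -> 0 <= t <= 1 by move=> /andP[? ?]; rewrite !ltW.
have real x : in_realisation end_adj (coord x).
  case: (cg_cover gr x) => [[u ->]|[e [t [t01 ->]]]].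
    split=> [a||]; first by rewrite cv ler0n.
      rewrite (bigD1 u) //= cv eqxx big1 ?addr0 // => a; rewrite cv eq_sym.
      by move=> /negPf ->.
    exists u, u; split=> [|a au _]; first by rewrite /estep eqxx.
    by rewrite cv eq_sym (negPf au).
  have /andP[t0 t1] := t01; split=> [a||].
  - by rewrite ce ?oo_cc // /bary addr_ge0 // mulr_ge0 ?ler0n ?subr_ge0 ?ltW.
  - rewrite (eq_bigr (bary e t)); last by move=> a _; rewrite ce ?oo_cc.
    rewrite (bigD1 (st e false)) //= (bigD1 (st e true)) /=; last by rewrite eq_sym loopless.
    rewrite bary_false bary_true big1 ?addr0 ?subrK // => a /andP[af at_].
    exact: bary_other.
  - exists (st e false), (st e true); split=> [|a af at_]; last by rewrite ce ?oo_cc ?bary_other.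
    by rewrite /estep; apply/orP; right; apply/end_adjP; exists e, false.
have surj u : in_realisation end_adj u -> exists x, forall a, coord x a = u a.
  move=> [u0 u1 [a [b [ab h]]]].
  have [/eqP ab'|ab'] := boolP (a == b).
    subst b; exists (v a) => d; rewrite cv; have [<-|ad] := eqVneq a d.
      by rewrite -u1 (bigD1 a) //= big1 ?addr0 // => d' da; exact: h.
    by rewrite h // eq_sym.
  have uab : u a + u b = 1.
    rewrite -u1 (bigD1 a) //= (bigD1 b) /=; last by rewrite eq_sym.
    by rewrite big1 ?addr0 // => d /andP[da db]; exact: h.
  move: ab; rewrite /estep (negPf ab') /= => /end_adjP[e [o [ea eb]]].
  pose t := u (st e true).
  have tf : u (st e false) = 1 - t.
    by rewrite /t; case: o ea eb => /= -> ->; lra.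
  have t01 : 0 <= t <= 1 by rewrite u0 /= -subr_ge0 -tf.
  exists (c e t) => d; rewrite ce //.
  have [->|df] := eqVneq d (st e false); first by rewrite bary_false.
  have [->|dt] := eqVneq d (st e true); first by rewrite bary_true.
  by rewrite bary_other // h //; move: df dt; case: o ea eb => /= -> ->.
have inj x y : (forall a, coord x a = coord y a) -> x = y.
  have vc u e t : 0 < t < 1 -> ~ (forall a, coord (v u) a = coord (c e t) a).
    move=> t01 h; have := h u; rewrite cv eqxx /= ce ?oo_cc //.
    have /andP[t0 t1] := t01.
    have [->|uf] := eqVneq u (st e false); first by rewrite bary_false => ?; lra.
    have [->|ut] := eqVneq u (st e true); first by rewrite bary_true => ?; lra.
    by rewrite bary_other // => ?; lra.
  case: (cg_cover gr x) => [[u ->]|[e [t [t01 ->]]]];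
    case: (cg_cover gr y) => [[u' ->]|[e' [t' [t01' ->]]]].
  - by move=> /(_ u'); rewrite !cv eqxx; case: eqP => [->//|_ /eqP]; rewrite eq_sym oner_eq0.
  - by move=> /(vc _ _ _ t01').
  - by move=> h; case: (vc u' e t t01) => a; rewrite h.
  - move=> h; have hb a : bary e t a = bary e' t' a by rewrite -!ce ?oo_cc.
    have /andP[t0 t1] := t01; have /andP[t0' t1'] := t01'.
    (* At an interior point exactly the two ends of the edge have nonzero coordinates, so the
       coordinates determine the ends; [simple_edges] then gives the edge. *)
    have mem a : bary e t a <> 0 -> exists b, a = st e' b.
      rewrite hb => hn; have [->|af] := eqVneq a (st e' false); first by exists false.
      have [->|at_] := eqVneq a (st e' true); first by exists true.
      by case: hn; rewrite bary_other.
    have [|bf ef] := mem (st e false); first by rewrite bary_false; lra.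
    have [|bt et] := mem (st e true); first by rewrite bary_true; lra.
    have ee : e = e'.
      apply: (simple_edges ef); rewrite et; congr (st e' _).
      have := loopless e; rewrite ef et; clear ef et.
      by case: bf bt => [] []; rewrite ?eqxx.
    by subst e'; congr (c e _); rewrite -(bary_true e t) hb bary_true.
pose mk u := if pselect (exists x, forall a, coord x a = u a) is left pf
  then sval (cid pf) else x0.
have mkP u a : in_realisation end_adj u -> coord (mk u) a = u a.
  by move=> /surj hu; rewrite /mk; case: pselect => // pf; case: cid.
have sm : smodel end_adj coord mk.
  split=> //; last 2 first.
  - by move=> u hu a; exact: mkP.
  - exact: (cg_compact gr).
  - move=> a b; apply/end_adjP/end_adjP => -[e [o [h1 h2]]]; by exists e, (~~ o); rewrite negbK.
  - move=> a; apply/negbTE/end_adjP => -[e [[] []]] /= <- h; have := loopless e;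
      by rewrite h eqxx.
exists coord, mk; split=> // a; apply: inj => b.
by rewrite (coord_vert sm) cv.
Qed.

End SimpleGraph.

(** The sum of the coordinates over the combinatorial component of [a] is continuous with values 0
    and 1, hence constant. *)
Lemma smodel_connected (R : realType) (G : topologicalType) (S : finType)
    (adj : rel S) (coord : G -> S -> R) mk : smodel adj coord mk ->
  connected [set: G] -> forall a b, exists2 p, path adj a p & last a p = b.
Proof.
move=> sm cG a b.
pose g x := \sum_(d | connect adj a d) coord x d.
have cg : continuous g by apply: cts_sum => d; exact: (sm_cts sm d).
have cstep c d : estep adj c d -> connect adj a c -> connect adj a d.
  by move=> /orP[/eqP <-//|cd] ac; apply: connect_trans ac (connect1 cd).
have g01 x : g x = 0 \/ g x = 1.
  have [_ x1 [c [d [cd h]]]] := sm_real sm x.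
  have out e : e != c -> e != d -> coord x e = 0 by exact: h.
  case: (boolP (connect adj a c)) => ac.
    have ad := cstep _ _ cd ac.
    right; rewrite -x1 /g [RHS](bigID (connect adj a)) /= [X in _ + X]big1 ?addr0 //.
    by move=> e ae; apply: out; apply: contraNneq ae => ->.
  left; apply: big1 => e ae; apply: out; apply: contraTneq ae => -> //.
  by apply: contra ac; apply: cstep; rewrite (estep_sym sm).
have gab := connected_two_valued (vert mk a) (vert mk b) cG cg g01.
have ga : g (vert mk a) = 1.
  rewrite /g (bigD1 a) ?connect0 //= big1 ?addr0 ?(coord_vert sm) ?eqxx //.
  by move=> d /andP[_ da]; rewrite (coord_vert sm) eq_sym (negPf da).
have : connect adj a b.
  apply: contrapT => /negP nab; move: ga; rewrite gab /g big1 => [/eqP|d ad].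
    by rewrite eq_sym oner_eq0.
  by rewrite (coord_vert sm); case: eqP => // bd; move: nab; rewrite bd ad.
by move=> /connectP[p pp ->]; exists p.
Qed.

Definition orient (R : realType) (b : bool) (t : R) : R := if b then t else 1 - t.

(** * Erasing a vertex of degree 2 *)

Section Merge.
Variables (R : realType) (X : topologicalType) (V E : finType).
Variables (v : V -> X) (c : E -> R -> X).
Hypothesis gr : cgraph v c.
Variables (e1 e2 : E) (b1 b2 : bool) (u0 : V).
Hypotheses (e12 : e1 != e2) (h1 : c e1 (bnd b1) = v u0) (h2 : c e2 (bnd b2) = v u0).
Hypothesis deg2 : forall e b, c e (bnd b) = v u0 ->
  (e, b) = (e1, b1) \/ (e, b) = (e2, b2).

Lemma orient_oo b (t : R) : 0 < t < 1 -> 0 < orient b t < 1.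
Proof. by rewrite /orient; case: b => // /andP[? ?]; apply/andP; split; lra. Qed.

Lemma orient_inj b : injective (@orient R b).
Proof. by rewrite /orient; case: b => // s t ?; lra. Qed.

Lemma orientK b : involutive (@orient R b).
Proof. by rewrite /orient; case: b => // t; ring. Qed.

(** [d1] runs along [e1] into [u0] and [d2] runs out of [u0] along [e2], whichever ends [b1] and
    [b2] are. *)
Let d1 (t : R) := c e1 (orient b1 t).
Let d2 (t : R) := c e2 (orient (~~ b2) t).
Let m := pcat d1 d2.

Lemma d1_1 : d1 1 = v u0.
Proof. by rewrite -h1 /d1 /orient; case: b1; rewrite /= ?subrr. Qed.

Lemma d2_0 : d2 0 = v u0.
Proof. by rewrite -h2 /d2 /orient; case: b2; rewrite /= ?subr0. Qed.

Lemma orient_cts b : continuous (@orient R b).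
Proof. by rewrite /orient; case: b; cts. Qed.

Lemma merged_cts : continuous m.
Proof.
apply: pcat_cts; last by rewrite d1_1 d2_0.
  exact: cts_comp (cg_cts gr e1) (@orient_cts b1).
exact: cts_comp (cg_cts gr e2) (@orient_cts (~~ b2)).
Qed.

Lemma merged_interior t : 0 < t < 1 ->
  [\/ exists2 s, 0 < s < 1 & s = orient b1 (2 * t) /\ m t = c e1 s,
      t = 1 / 2 /\ m t = v u0 |
      exists2 s, 0 < s < 1 & s = orient (~~ b2) (2 * t - 1) /\ m t = c e2 s].
Proof.
move=> /andP[t0 t1]; rewrite /m pcatE.
case: (ltgtP t (1 / 2)) => ht.
- constructor 1; exists (orient b1 (2 * t)) => //.
  by apply: orient_oo; apply/andP; split; lra.
- constructor 3; exists (orient (~~ b2) (2 * t - 1)) => //.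
  by apply: orient_oo; apply/andP; split; lra.
- constructor 2; split; [lra|rewrite -d1_1; congr d1; lra].
Qed.

(** The slot of [e1] receives the merged edge [m], and [e2] and [u0] disappear. By [e12] the two
    edge ends do not belong to one loop, which could not be shortened in this way. *)
Lemma merge_edges : exists (V' E' : finType) (v' : V' -> X) (c' : E' -> R -> X),
  cgraph v' c' /\ (#|E'| < #|E|)%N.
Proof.
pose c' (e : {e | e != e2}) := if val e == e1 then m else c (val e).
pose v' (u : {u | u != u0}) := v (val u).
exists {u | u != u0}, {e | e != e2}, v', c'; split; last first.
  by rewrite card_sig [X in (_ < X)%N](cardD1 e2) inE add1n ltnS; apply: subset_leq_card;
    apply/fintype.subsetP => e; rewrite !inE andbT.
have vE u : u != u0 -> exists u', v u = v' u' by move=> uu; exists (Sub u uu).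
have m12 t t' : 0 < t < 1 -> 0 < t' < 1 -> m t = m t' -> t = t'.
  move=> t01 t01'; case: (merged_interior t01) => [[s s01 [sE ->]]|[tE ->]|[s s01 [sE ->]]];
  case: (merged_interior t01') => [[s' s01' [sE' ->]]|[tE' ->]|[s' s01' [sE' ->]]].
  - by move=> /(cg_int_inj gr s01 s01')[_]; rewrite sE sE' => /orient_inj; lra.
  - by move=> /(cg_int gr s01).
  - by move=> /(cg_int_inj gr s01 s01')[e12']; case/eqP: e12.
  - by move=> /esym/(cg_int gr s01').
  - by rewrite tE tE'.
  - by move=> /esym/(cg_int gr s01').
  - by move=> /(cg_int_inj gr s01 s01')[/esym e12']; case/eqP: e12.
  - by move=> /(cg_int gr s01).
  - by move=> /(cg_int_inj gr s01 s01')[_]; rewrite sE sE' => /orient_inj; lra.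
have mc t e s : 0 < t < 1 -> 0 < s < 1 -> e != e1 -> e != e2 -> m t <> c e s.
  move=> t01 s01 n1 n2; case: (merged_interior t01) => [[r r01 [_ ->]]|[_ ->]|[r r01 [_ ->]]].
  - by move=> /(cg_int_inj gr r01 s01)[ee]; case/eqP: n1.
  - by move=> /esym/(cg_int gr s01).
  - by move=> /(cg_int_inj gr r01 s01)[ee]; case/eqP: n2.
split.
- by move=> x y /(cg_inj gr) /val_inj.
- by move=> e; rewrite /c'; case: eqP => _; [exact: merged_cts|exact: (cg_cts gr)].
- move=> [e ne2] b; rewrite /c' /=; case: eqP => [ee|ne1].
    have end' e' b' : ~ ((e', b') = (e1, b1) \/ (e', b') = (e2, b2)) ->
        exists u, c e' (bnd b') = v' u.
      move=> nh; have [u cu] := cg_end gr e' b'.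
      have [uu|uu] := eqVneq u u0; first by case: nh; apply: deg2; rewrite cu uu.
      by rewrite cu; exact: vE.
    case: b; rewrite /= /m ?pcat0 ?pcat1.
      have -> : d2 1 = c e2 (bnd (~~ b2)) by rewrite /d2 /orient; case: b2; rewrite /= ?subrr.
      apply: end' => -[[e21]|[]]; first by case/eqP: e12.
      by case: b2.
    have -> : d1 0 = c e1 (bnd (~~ b1)) by rewrite /d1 /orient; case: b1; rewrite /= ?subr0.
    apply: end' => -[[]|[e21]]; last by case/eqP: e12.
    by case: b1.
  have [u cu] := cg_end gr e b.
  have [uu|uu] := eqVneq u u0; last by rewrite cu; exact: vE.
  by case: (@deg2 e b) => [|[ee _]|[ee _]]; [rewrite cu uu|case: ne1|case/eqP: ne2].
- move=> [e ne2] t [u uu] t01; rewrite /c' /v' /=; case: eqP => [ee|ne1]; last exact: (cg_int gr).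
  case: (merged_interior t01) => [[s s01 [_ ->]]|[_ ->]|[s s01 [_ ->]]]; try exact: (cg_int gr).
  by move=> /(cg_inj gr) uE; move: uu; rewrite uE eqxx.
- move=> [e ne2] [e' ne2'] t t' t01 t01'; rewrite /c' /=.
  case: eqP => [ee|/eqP ne1]; case: eqP => [ee'|/eqP ne1'].
  + by move=> /(m12 _ _ t01 t01') ->; split=> //; apply: val_inj; rewrite /= ee ee'.
  + by move=> /(mc _ _ _ t01 t01' ne1' ne2').
  + by move=> /esym/(mc _ _ _ t01' t01 ne1 ne2).
  + by move=> /(cg_int_inj gr t01 t01')[ee ->]; split=> //; exact: val_inj.
- move=> x; case: (cg_cover gr x) => [[u ->]|[e [t [t01 ->]]]].
    have [->|uu] := eqVneq u u0; last by left; exact: vE.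
    right; exists (Sub e1 e12), (1 / 2); split; first by apply/andP; split; lra.
    rewrite /c' /= eqxx -d1_1 /m pcatE lexx; congr d1; lra.
  have [->|ne1] := eqVneq e e1.
    right; exists (Sub e1 e12), (orient b1 t / 2).
    have /andP[o0 o1] := orient_oo b1 t01.
    split; first by apply/andP; split; lra.
    rewrite /c' /= eqxx /m pcatE.
    have -> : orient b1 t / 2 <= 1 / 2 by lra.
    by rewrite /d1 (_ : 2 * _ = orient b1 t) ?orientK //; lra.
  have [->|ne2] := eqVneq e e2.
    right; exists (Sub e1 e12), ((orient (~~ b2) t + 1) / 2).
    have /andP[o0 o1] := orient_oo (~~ b2) t01.
    split; first by apply/andP; split; lra.
    rewrite /c' /= eqxx /m pcatE.
    have -> : ((orient (~~ b2) t + 1) / 2 <= 1 / 2) = false by apply/negbTE; lra.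
    by rewrite /d2 (_ : 2 * _ - 1 = orient (~~ b2) t) ?orientK //; lra.
  by right; exists (Sub e ne2), t; rewrite /c' /= (negPf ne1).
- exact: (cg_hausdorff gr).
Qed.

End Merge.

(** * Existence of an essential vertex *)

Section CircleParameter.
Variable R : realType.

(* [circle_map w] runs once around the circle for [w] in [-1, 1]. *)
Definition circle_map (w : R) : R * R :=
  (2 * `|w| - 1, 2 * (Num.sqrt w - Num.sqrt (- w)) * Num.sqrt (1 - `|w|)).

(** For [w] the square of the cosine of half an angle, this is the point of the upper half circle at
    that angle. Since [Num.sqrt] is 0 on negative numbers, one of the two roots in [circle_map]
    drops out. *)
Lemma circle_map_pos w : 0 <= w -> circle_map w = (2 * w - 1, 2 * Num.sqrt w * Num.sqrt (1 - w)).
Proof.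
by move=> w0; rewrite /circle_map ger0_norm // (ler0_sqrtr (a := - w)) ?oppr_le0 // subr0.
Qed.

Lemma circle_map_neg w : w <= 0 ->
  circle_map w = (- 2 * w - 1, - 2 * Num.sqrt (- w) * Num.sqrt (1 + w)).
Proof.
by move=> w0; rewrite /circle_map ler0_norm // (ler0_sqrtr (a := w)) // sub0r opprK !mulrN !mulNr.
Qed.

Lemma circle_map_circle w : -1 <= w <= 1 ->
  (circle_map w).1 ^+ 2 + (circle_map w).2 ^+ 2 = 1.
Proof.
move=> /andP[w1 w2]; have [w0|w0] := leP 0 w.
  rewrite circle_map_pos //= !exprMn !sqr_sqrtr ?subr_ge0 //; ring.
rewrite circle_map_neg ?ltW //= !exprMn !sqr_sqrtr; [ring|lra|lra].
Qed.

Lemma circle_map_cts (T : topologicalType) (f : T -> R) :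
  continuous f -> continuous (fun x => circle_map (f x)).
Proof.
move=> cf; have cs (g : T -> R) : continuous g -> continuous (fun x => Num.sqrt (g x)).
  by move=> cg; exact: cts_comp (@realfun.sqrt_continuous R) cg.
by rewrite /circle_map; cts; apply: cs; cts.
Qed.

(** The parameter -1 is excluded because it gives the same point as 1. For parameters of opposite
    signs the second coordinates differ: one is negative, the other is not. *)
Lemma circle_map_inj w w' : -1 < w <= 1 -> -1 < w' <= 1 ->
  circle_map w = circle_map w' -> w = w'.
Proof.
wlog : w w' / w <= w'.
  move=> W h h' e; case: (leP w w') => [|/ltW] l; first exact: W.
  by symmetry; apply: W.
move=> l /andP[w1 w2] /andP[w1' w2'].
have [w0|w0] := leP 0 w.
  by rewrite !circle_map_pos ?(le_trans w0) // => -[? _]; lra.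
have [w0'|w0'] := leP w' 0.
  by rewrite !circle_map_neg ?(ltW w0) // => -[? _]; lra.
rewrite circle_map_neg ?(ltW w0) // circle_map_pos ?(ltW w0') // => -[e1 e2].
have n : 0 < Num.sqrt (- w) by rewrite sqrtr_gt0; lra.
have n2 : 0 < Num.sqrt (1 + w) by rewrite sqrtr_gt0; lra.
have p : 0 <= Num.sqrt w' by exact: sqrtr_ge0.
have p2 : 0 <= Num.sqrt (1 - w') by exact: sqrtr_ge0.
have := mulr_gt0 n n2; have := mulr_ge0 p p2; lra.
Qed.

Lemma circle_map_surj (z : R * R) : z.1 ^+ 2 + z.2 ^+ 2 = 1 ->
  exists2 w, -1 <= w <= 1 & circle_map w = z.
Proof.
case: z => x y /= xy.
have x1 : -1 <= x <= 1.
  have y0 := sqr_ge0 y; apply/andP; split; nra.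
have /andP[xl xr] := x1.
have sq (a : R) : 0 <= a <= 1 -> (2 * Num.sqrt a * Num.sqrt (1 - a)) ^+ 2 = 4 * a * (1 - a).
  by move=> /andP[a0 a1]; rewrite !exprMn !sqr_sqrtr ?subr_ge0 //; ring.
(* The first coordinate [2 * |w| - 1] forces the absolute value of [w] to be [a]; the sign of [y]
   selects that of [w]. *)
pose a := (x + 1) / 2.
have a01 : 0 <= a <= 1 by rewrite /a; apply/andP; split; lra.
have ay : (2 * Num.sqrt a * Num.sqrt (1 - a)) ^+ 2 = y ^+ 2.
  have -> : y ^+ 2 = 1 - x ^+ 2 by rewrite -xy; ring.
  by rewrite sq // /a; field.
have ra : 0 <= 2 * Num.sqrt a * Num.sqrt (1 - a).
  by rewrite !mulr_ge0 // sqrtr_ge0.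
have /andP[a0 a1] := a01.
have [y0|y0] := leP 0 y.
  exists a; first by apply/andP; split; lra.
  rewrite circle_map_pos //; congr pair; first by rewrite /a; field.
  by apply/eqP; rewrite -(@eqrXn2 _ 2) // ay.
exists (- a); first by apply/andP; split; lra.
rewrite circle_map_neg ?oppr_le0 // opprK; congr pair; first by rewrite /a; field.
have yE : 2 * Num.sqrt a * Num.sqrt (1 - a) = - y.
  by apply/eqP; rewrite -(@eqrXn2 _ 2) ?sqrrN ?ay // oppr_ge0 ltW.
by rewrite -[y]opprK -yE; ring.
Qed.

End CircleParameter.

Section EssentialVertex.
Variables (R : realType) (X : topologicalType) (V E : finType).
Variables (v : V -> X) (c : E -> R -> X) (st : E -> bool -> V).
Hypotheses (gr : cgraph v c) (cst : forall e b, c e (bnd b) = v (st e b)).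
Hypothesis Xc : connected [set: X].

Lemma edgeless_point (x y : X) : (E -> False) -> x = y.
Proof.
move=> noE.
have [u ->] : exists u, x = v u by case: (cg_cover gr x) => // -[e]; case: (noE e).
have [w ->] : exists u, y = v u by case: (cg_cover gr y) => // -[e]; case: (noE e).
have [||g [cg gv _]] := @cell_glue1 R X V E v c gr R (fun w => (w == u)%:R) (fun _ _ => 0).
- by move=> e; case: (noE e).
- by move=> e; case: (noE e).
have g01 z : g z = 0 \/ g z = 1.
  case: (cg_cover gr z) => [[w' ->]|[e]]; last by case: (noE e).
  by rewrite gv; case: eqP; [right|left].
have := connected_two_valued (v u) (v w) Xc cg g01.
rewrite !gv eqxx; case: eqP => [->//|_ /eqP]; by rewrite oner_eq0.
Qed.

(** If no other edge is attached to the ends of [e], the indicator function of the closed edge is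
    continuous, hence constant. *)
Lemma isolated_edge e : (forall e' b b', st e' b' = st e b -> e' = e) ->
  forall x, exists2 t, 0 <= t <= 1 & x = c e t.
Proof.
move=> iso.
have [||g [cg gv ge]] := @cell_glue1 R X V E v c gr R
  (fun w => ((w == st e false) || (w == st e true))%:R) (fun e' _ => (e' == e)%:R).
- by move=> e'; exact: cst_continuous.
- move=> e' b u; rewrite cst => /(cg_inj gr) <-; congr (nat_of_bool _)%:R.
  apply/eqP/orP => [->|[/eqP|/eqP]]; last 2 first; [exact: iso|exact: iso|].
  by case: b; rewrite eqxx; [right|left].
have g01 z : g z = 0 \/ g z = 1.
  case: (cg_cover gr z) => [[w' ->]|[e' [t [/andP[t0 t1] ->]]]].
    by rewrite gv; case: (_ || _); [right|left].
  by rewrite ge; [case: eqP; [right|left]|rewrite !ltW].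
have e0 : g (c e 0) = 1 by rewrite ge ?eqxx // lexx ler01.
move=> x; have gx : g x = 1 by rewrite (connected_two_valued x (c e 0) Xc cg g01).
case: (cg_cover gr x) gx => [[u ->]|[e' [t [/andP[t0 t1] ->]]]].
  rewrite gv; case: eqP => [-> _|_].
    by exists 0; rewrite ?lexx ?ler01 // -cst.
  case: eqP => [-> _|_ /eqP]; last by rewrite eq_sym oner_eq0.
  by exists 1; rewrite ?lexx ?ler01 // -cst.
rewrite ge; last by rewrite !ltW.
case: eqP => [-> _|_ /eqP]; last by rewrite eq_sym oner_eq0.
by exists t => //; rewrite !ltW.
Qed.

Lemma loop_circle e : (forall x, exists2 t, 0 <= t <= 1 & x = c e t) ->
  st e false = st e true -> homeomorphic X (circle R).
Proof.
move=> cov loop.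
have pi (t : R) : circle_map (1 - 2 * clamp t) \in
    ([set z : R * R | z.1 ^+ 2 + z.2 ^+ 2 = 1]).
  rewrite inE /=; apply: circle_map_circle; have /andP[? ?] := clamp_itv t.
  by apply/andP; split; lra.
pose k (t : R) : circle R := SigSub (pi t).
have ck : continuous k.
  apply: continuous_comp_initial; rewrite /comp /=.
  by apply: circle_map_cts; cts; apply: clamp_cts; exact: cts_id.
have kE t : 0 <= t <= 1 -> set_val (k t) = circle_map (1 - 2 * t).
  by move=> t01; rewrite -[in RHS](clamp_id t01).
have k01 : k 1 = k 0.
  apply: val_inj; rewrite /= clamp0 clamp1 /circle_map.
  rewrite (_ : 1 - 2 * 1 = -1); last by ring.
  by rewrite (_ : 1 - 2 * 0 = 1) ?normrN ?normr1 ?subrr ?sqrtr0 ?mulr0 //; ring.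
have [||g [cg gv ge]] := @cell_glue1 R X V E v c gr (circle R) (fun _ => k 0) (fun _ t => k t).
- by move=> _; exact: ck.
- by move=> e' [] u _ //=; rewrite k01.
(* The loop identifies the parameters 1 and 0. Without 1, the number [1 - 2 * t] avoids -1 and
   [circle_map_inj] applies. *)
have cov' x : exists2 t, 0 <= t < 1 & x = c e t.
  have [t /andP[t0]] := cov x; rewrite le_eqVlt => /predU1P[-> ->|t1 ->].
    exists 0; first by rewrite lexx ltr01.
    by have := cst e false; have := cst e true; rewrite /= -loop => -> ->.
  by exists t; rewrite ?t0.
have chaus : hausdorff_space (circle R).
  have hRR : hausdorff_space (R * R)%type by apply: hausdorff_pair; exact: Rhausdorff.
  move=> z z' cl; apply: val_inj; apply: hRR => A B Az Bz'.
  have ci : continuous (set_val : circle R -> R * R) by exact: initial_continuous.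
  by have [w [Aw Bw]] := cl _ _ (ci z A Az) (ci z' B Bz'); exists (set_val w).
apply: compact_bijection_homeomorphism chaus cg _ _.
- exact: (cg_compact gr).
- move=> x y; have [s /andP[s0 s1] ->] := cov' x; have [t /andP[t0 t1] ->] := cov' y.
  rewrite !ge; [|by rewrite t0 ltW|by rewrite s0 ltW].
  move=> /(congr1 set_val); rewrite !kE; [|by rewrite t0 ltW|by rewrite s0 ltW].
  move=> /circle_map_inj h; have st2 : 1 - 2 * s = 1 - 2 * t.
    by apply: h; apply/andP; split; lra.
  by congr (c e _); lra.
- move=> z; have := valP z; rewrite inE /= => /circle_map_surj[w /andP[w1 w2] wz].
  have t01 : 0 <= (1 - w) / 2 <= 1 by apply/andP; split; lra.
  exists (c e ((1 - w) / 2)); rewrite ge //.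
  have := kE _ t01; rewrite (_ : 1 - 2 * ((1 - w) / 2) = w); last by field.
  by rewrite wz => h; exact: val_inj h.
Qed.

Lemma arc_interval e : (forall x, exists2 t, 0 <= t <= 1 & x = c e t) ->
  st e false != st e true -> homeomorphic X (unit_interval R).
Proof.
move=> cov ne; apply: homeomorphic_sym.
apply: (@compact_bijection_homeomorphism _ _ (fun t => c e (set_val t))).
- exact: unit_compact.
- exact: (cg_hausdorff gr).
- exact: cts_comp (cg_cts gr e) (@set_val_cts R).
- move=> s t h; suff : set_val s = set_val t by move=> /val_inj.
  move: h => /=.
  case: (itv01P (unit_itv s)) => [[b ->]|s01]; case: (itv01P (unit_itv t)) => [[b' ->]|t01].
  + rewrite !cst => /(cg_inj gr) h; suff -> : b = b' by [].
    by case: b b' h => [] [] // h; move: ne; rewrite h eqxx.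
  + by rewrite cst => /esym/(cg_int gr t01).
  + by rewrite cst => /(cg_int gr s01).
  + by move=> /(cg_int_inj gr s01 t01)[].
- move=> x; have [t t01 ->] := cov x; exists (clampI t).
  by rewrite clampIE clamp_id.
Qed.

End EssentialVertex.

(** Degree is counted by edge ends [(e, b)], so that a loop contributes two. *)
Theorem essential_vertex (R : realType) (X : topologicalType) (V E : finType)
    (v : V -> X) (c : E -> R -> X) : cgraph v c -> connected [set: X] ->
  ~ (forall x y : X, x = y) -> ~ homeomorphic X (circle R) ->
  ~ homeomorphic X (unit_interval R) ->
  exists (V E : finType) (v : V -> X) (c : E -> R -> X), cgraph v c /\
   exists w h1 h2 h3, [/\ h1 != h2, h1 != h3, h2 != h3 &
    forall h, h \in [:: h1; h2; h3] -> c h.1 (bnd h.2) = v w].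
Proof.
move=> gr0 Xc npt ncirc nint.
pose P n := `[< exists (V E : finType) (v : V -> X) (c : E -> R -> X),
  cgraph v c /\ #|E| = n >].
have exP : exists n, P n by exists #|E|; apply/asboolP; exists V, E, v, c.
case: (ex_minnP exP) => n /asboolP[V1 [E1 [v1 [c1 [gr En]]]]] nmin {gr0 v c V E exP}.
exists V1, E1, v1, c1; split=> //; apply: contrapT => no3.
have /choice[st stP] : forall eb : E1 * bool, exists u, c1 eb.1 (bnd eb.2) = v1 u.
  by move=> [e b]; exact: (cg_end gr).
pose st' e b := st (e, b).
have cst e b : c1 e (bnd b) = v1 (st' e b) by rewrite -stP.
have [e] : exists e : E1, True.
  apply: contrapT => noE; apply: npt => x y; apply: (edgeless_point gr Xc) => e.
  by apply: noE; exists e.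
move=> _.
(* If two different edges meet, either their two ends are the only ones there and merging
   contradicts minimality, or a third end contradicts [no3]. *)
have iso e' b b' : st' e' b' = st' e b -> e' = e.
  move=> ee'; apply: contrapT => /eqP ne.
  case: (pselect (forall e0 b0, c1 e0 (bnd b0) = v1 (st' e b) ->
      (e0, b0) = (e', b') \/ (e0, b0) = (e, b))) =>
    [deg2|/existsNP[e0 /existsNP[b0 /not_implyP[h /not_orP[n1 n2]]]]].
    have [|V2 [E2 [v2 [c2 [gr2 lt2]]]]] := merge_edges gr ne _ (cst e b) deg2.
      by rewrite cst ee'.
    have : P #|E2| by apply/asboolP; exists V2, E2, v2, c2.
    by move=> /nmin; rewrite -En leqNgt lt2.
  apply: no3; exists (st' e b), (e', b'), (e, b), (e0, b0); split.
  - by apply/eqP => -[ee _]; case/eqP: ne.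
  - by rewrite eq_sym; apply/eqP.
  - by rewrite eq_sym; apply/eqP.
  - by move=> h'; rewrite !inE => /orP[/eqP->|/orP[/eqP->|/eqP->]] //=; rewrite cst ?ee'.
have cov := isolated_edge gr cst Xc iso.
have [loop|ne] := eqVneq (st' e false) (st' e true).
  exact/ncirc/(loop_circle gr cst cov).
exact/nint/(arc_interval gr cst cov).
Qed.

Theorem graph_smodel (R : realType) (X : topologicalType) (x0 : X) :
  finite_graph R X -> connected [set: X] -> ~ (forall x y : X, x = y) ->
  ~ homeomorphic X (circle R) -> ~ homeomorphic X (unit_interval R) ->
  exists (S : finType) (adj : rel S) (coord : X -> S -> R) (mk : (S -> R) -> X),
  [/\ smodel adj coord mk,
      exists w n1 n2 n3, [/\ adj w n1, adj w n2 & adj w n3] /\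
        [/\ n1 != n2, n1 != n3 & n2 != n3] &
      exists s0, vert mk s0 = x0].
Proof.
move=> [V0 [E0 [v0 [c0 gs]]]] Xc npt ncirc nint.
have [V [E [v [c [gr [w [h1 [h2 [h3 [n12 n13 n23 hw]]]]]]]]]] :=
  essential_vertex (graph_structure_cgraph gs) Xc npt ncirc nint.
have /choice[st' stP] : forall eb : E * bool, exists u, c eb.1 (bnd eb.2) = v u.
  by move=> [e b]; exact: (cg_end gr).
(* The first cut is placed at [x0] if [x0] is interior to the edge, so that [x0] becomes a vertex;
   the other cuts are arbitrary. *)
have /choice[pq pqP] : forall e, exists pq : R * R,
    [/\ 0 < pq.1, pq.1 < pq.2 & pq.2 < 1] /\
    (forall t, 0 < t < 1 -> x0 = c e t -> pq.1 = t).
  move=> e; case: (pselect (exists2 t, 0 < t < 1 & x0 = c e t)) => [[t t01 xt]|no].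
    have /andP[t0 t1] := t01.
    exists (t, (1 + t) / 2); split=> [|s s01]; first by split=> /=; lra.
    by rewrite xt => /(cg_int_inj gr t01 s01)[].
  exists (1 / 3, 2 / 3); split=> [|t t01 xt]; first by split=> /=; lra.
  by case: no; exists t.
pose p e := (pq e).1; pose q e := (pq e).2.
have pq01 e : [/\ 0 < p e, p e < q e & q e < 1] by have [] := pqP e.
have gr' := cut_cgraph gr pq01.
pose st (e : E * option bool) (b : bool) : V + E * bool :=
  match e.2, b with
  | Some false, false => inl (st' (e.1, false))
  | Some false, true => inr (e.1, false)
  | None, false => inr (e.1, false)
  | None, true => inr (e.1, true)
  | Some true, false => inr (e.1, true)
  | Some true, true => inl (st' (e.1, true))
  end.
have cst e b : cut_edge c p q e (bnd b) = cut_vertex v c p q (st e b).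
  case: e => e o; rewrite /cut_edge /cut_left /cut_right /=.
  by case: o b => [[]|] [] /=; rewrite ?aff0 ?aff1 //= -stP.
have loopless e : st e false != st e true 
  by case: e => e [[]|]; apply/eqP; rewrite /st /=; congruence.
have simple_edges e e' b : st e false = st e' b -> st e true = st e' (~~ b) -> e = e'.
  by case: e e' b => [e [[]|]] [e' [[]|]] []; rewrite /st /=; congruence.
have [coord [mk [sm mkv]]] := simple_smodel x0 gr' cst loopless simple_edges.
exists (V + E * bool)%type, (end_adj st), coord, mk; split=> //.
  (* The edge end [(e, b)] at [w] leads to the cut point [inr (e, b)]. Distinct ends thus give
     distinct neighbours, even when two of them belong to one loop. *)
  have adjw h : h \in [:: h1; h2; h3] -> end_adj st (inl w) (inr h).
    case: h => e b /hw /=; rewrite (stP (e, b)) => /(cg_inj gr) stw.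
    by apply/end_adjP; exists (e, Some b), b; rewrite -stw; case: b {stw}.
  exists (inl w), (inr h1), (inr h2), (inr h3); split; split.
  - by apply: adjw; rewrite !inE eqxx.
  - by apply: adjw; rewrite !inE eqxx orbT.
  - by apply: adjw; rewrite !inE eqxx !orbT.
  - by apply: contra_neq n12 => -[].
  - by apply: contra_neq n13 => -[].
  - by apply: contra_neq n23 => -[].
case: (cg_cover gr x0) => [[u xu]|[e [t [t01 xt]]]].
  by exists (inl u); rewrite mkv.
exists (inr (e, false)); rewrite mkv /= xt; congr (c e _).
by have [_ h] := pqP e; exact: h.
Qed.

(** * Equivariant cell structures *)

Section Involution.
Variables (R : realType) (X : topologicalType) (tau : X -> X).
Hypothesis ft : free_involution tau.

Section InvariantVertices.
Variables (V E : finType) (v : V -> X) (c : E -> R -> X) (rho : V -> V).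
Hypotheses (gr : cgraph v c) (tau_v : forall u, tau (v u) = v (rho u)).

Let inside e x := exists t, 0 < t < 1 /\ x = c e t.

Lemma inside_uniq e e' x : inside e x -> inside e' x -> e = e'.
Proof. by move=> [t [t01 ->]] [s [s01 /(cg_int_inj gr t01 s01)[]]]. Qed.

Lemma tau_inside e t : 0 < t < 1 -> exists e', inside e' (tau (c e t)).
Proof.
move=> t01; case: (cg_cover gr (tau (c e t))) => [[u h]|[e' [s [s01 ->]]]].
  by case: (cg_int gr (e := e) (u := rho u) t01); rewrite -tau_v -h (finv_involutive ft).
by exists e', s.
Qed.

Lemma half_oo : 0 < (1 / 2 : R) < 1.
Proof. by apply/andP; split; lra. Qed.

Lemma connected_oo : connected (`]0, 1[%classic : set R).
Proof. by apply/connected_intervalP; exact: interval_is_interval. Qed.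

(** The edge containing [tau (c e t)] is locally constant in [t], since open edges are open in [X]
    (there [k1] is positive). *)
Lemma tau_edge e : exists e', forall t, 0 < t < 1 -> inside e' (tau (c e t)).
Proof.
have [e' he'] := tau_inside e half_oo; exists e' => t t01.
have oo (s : R) : 0 < s < 1 -> (`]0, 1[%classic : set R) s by rewrite /= in_itv.
apply: (@connected_locally_constant _ _ (fun z => inside e' (tau (c e z)))
  connected_oo _ _ _ (oo _ half_oo) (oo _ t01) he').
move=> s; rewrite /= in_itv /= => s01.
have [e'' h''] := tau_inside e s01.
have [k1 [k2 [ck1 _ _ k1P]]] := edge_coordinates gr e''.
have : \forall y \near s, 0 < k1 (tau (c e y)).
  apply: open_nbhs_nbhs; split; last by apply/k1P.
  apply: open_lt_cts; first exact: cst_continuous.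
  apply: (cts_comp ck1); apply: (cts_comp (finv_continuous ft)); exact: (cg_cts gr).
apply: filterS => y /k1P hy _.
by split=> h; [rewrite (inside_uniq h h'')|rewrite (inside_uniq h hy)].
Qed.

(** If [tau (c e t) = c e s], then [D t] has the sign of [s - t]. It never vanishes because [tau] is
    free, so its sign is constant; but the midpoint and its image are exchanged, which gives
    opposite signs. *)
Lemma tau_fixes_no_edge e : ~ (forall t, 0 < t < 1 -> inside e (tau (c e t))).
Proof.
move=> he; have [k1 [k2 [ck1 ck2 kE k1P]]] := edge_coordinates gr e.
pose D t := k2 (tau (c e t)) - t * k1 (tau (c e t)).
have cD : continuous D.
  have ct : continuous (fun t => tau (c e t)).
    apply: (cts_comp (finv_continuous ft)); exact: (cg_cts gr).
  by rewrite /D; cts; [exact: cts_comp ck2 ct|exact: cts_comp ck1 ct].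
have DE t s : 0 < t < 1 -> 0 < s < 1 -> tau (c e t) = c e s -> (0 < D t) = (t < s).
  move=> t01 s01 ts; have /andP[s0 s1] := s01; rewrite /D ts.
  have [|-> ->] := kE s; first by rewrite !ltW.
  have -> : s * s * (1 - s) - t * (s * (1 - s)) = (s - t) * (s * (1 - s)) by ring.
  by rewrite pmulr_lgt0 ?subr_gt0 // mulr_gt0 // subr_gt0.
have oo (s : R) : 0 < s < 1 -> (`]0, 1[%classic : set R) s by rewrite /= in_itv.
have const t s : 0 < t < 1 -> 0 < s < 1 -> 0 < D t -> 0 < D s.
  move=> t01 s01; apply: (@connected_locally_constant _ _ (fun z => 0 < D z)
    connected_oo _ _ _ (oo _ t01) (oo _ s01)).
  move=> r; rewrite /= in_itv /= => r01; case: (ltgtP 0 (D r)) => [Dr|Dr|Dr].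
  - have : \forall y \near r, 0 < D y.
      apply: open_nbhs_nbhs; split=> //.
      by apply: open_lt_cts => //; exact: cst_continuous.
    by apply: filterS => y Dy _; split.
  - have : \forall y \near r, D y < 0.
      apply: open_nbhs_nbhs; split=> //.
      by apply: open_lt_cts => //; exact: cst_continuous.
    by apply: filterS => y Dy _; split=> // Dy'; have := lt_trans Dy Dy'; rewrite ltxx.
  - have [s' [s'01 rs]] := he _ r01; have /andP[s0 s1] := s'01.
    case: (finv_free ft (x := c e r)); rewrite rs; congr (c e _).
    move: Dr; rewrite /D rs; have [|-> ->] := kE s'; first by rewrite !ltW.
    have -> : s' * s' * (1 - s') - r * (s' * (1 - s')) = (s' - r) * (s' * (1 - s')) by ring.
    move=> /esym/eqP; rewrite !mulf_eq0 !subr_eq0 (gt_eqF s0) (gt_eqF s1) !orbF.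
    by move=> /eqP.
have [s [s01 hs]] := he _ half_oo.
have hs' : tau (c e s) = c e (1 / 2) by rewrite -hs (finv_involutive ft).
have D1 := DE _ _ half_oo s01 hs; have D2 := DE _ _ s01 half_oo hs'.
case: (ltgtP (1 / 2) s) => lt.
- have := const _ _ half_oo s01; rewrite D1 D2 => /(_ lt) lt'.
  by have := lt_trans lt lt'; rewrite ltxx.
- have := const _ _ s01 half_oo; rewrite D1 D2 => /(_ lt) lt'.
  by have := lt_trans lt lt'; rewrite ltxx.
- by apply: (finv_free ft (x := c e s)); rewrite hs' lt.
Qed.

(** Of each pair of edges exchanged by [tau], the one of smaller rank keeps its characteristic map,
    and the other is reparametrised as its [tau]-image. This makes [tau] preserve parameters. *)
Lemma invariant_vertices_structure : exists (E' : finType) (c' : E' * bool -> R -> X),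
  cgraph v c' /\ forall e b t, tau (c' (e, b) t) = c' (e, ~~ b) t.
Proof.
have /choice[s sP] := tau_edge.
have ss e : s (s e) = e.
  have [t [t01 ht]] := sP e _ half_oo.
  apply: (@inside_uniq _ _ (c e (1 / 2))); last by exists (1 / 2); split=> //; exact: half_oo.
  by rewrite -(finv_involutive ft (c e (1 / 2))) ht; exact: sP.
have sne e : s e != e.
  by apply/eqP => se; apply: (@tau_fixes_no_edge e); rewrite -{1}se; exact: sP.
pose half e := (enum_rank e < enum_rank (s e))%N.
pose c' (e : {e | half e} * bool) (t : R) :=
  if e.2 then tau (c (val e.1) t) else c (val e.1) t.
have tt := finv_involutive ft.
exists {e | half e}, c'; split; last first.
  by move=> e [] t; rewrite /c' /= ?tt.
have cross (e e' : {e | half e}) t t' : 0 < t < 1 -> 0 < t' < 1 ->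
    c (val e) t <> tau (c (val e') t').
  move=> t01 t01' h.
  have : val e = s (val e').
    apply: (@inside_uniq _ _ (c (val e) t)); first by exists t.
    by rewrite h; exact: sP.
  have := valP e; have := valP e'; rewrite /half => l1 l2 ee.
  move: l2; rewrite ee ss => l2; by have := ltn_trans l1 l2; rewrite ltnn.
split.
- exact: (cg_inj gr).
- move=> [e []]; rewrite /c' /=; last exact: (cg_cts gr).
  by apply: (cts_comp (finv_continuous ft)); exact: (cg_cts gr).
- move=> [e b] b'; have [u cu] := cg_end gr (val e) b'; rewrite /c' /=.
  by case: b; [exists (rho u); rewrite cu tau_v|exists u].
- move=> [e b] t u t01; rewrite /c' /=; case: b; last exact: (cg_int gr).
  by move=> h; apply: (cg_int gr (e := val e) (u := rho u) t01); rewrite -tau_v -h tt.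
- move=> [e b] [e' b'] t t' t01 t01'; rewrite /c' /=; case: b b' => [] [].
  + move=> /(congr1 tau); rewrite !tt => /(cg_int_inj gr t01 t01')[ee ->].
    by split=> //; congr pair; exact: val_inj.
  + by move=> /esym /(cross _ _ _ _ t01' t01).
  + by move=> /(cross _ _ _ _ t01 t01').
  + move=> /(cg_int_inj gr t01 t01')[ee ->].
    by split=> //; congr pair; exact: val_inj.
- move=> x; case: (cg_cover gr x) => [|[e [t [t01 ->]]]]; first by left.
  right; case: (ltngtP (enum_rank e) (enum_rank (s e))) => he.
  + by exists (Sub e he, false), t.
  + have hse : half (s e) by rewrite /half ss.
    have [t' [t01' h]] := sP e _ t01.
    by exists (Sub (s e) hse, true), t'; rewrite /c' /= -h tt.
  + by have := sne e; rewrite -(inj_eq enum_rank_inj) -val_eqE /= he eqxx.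
- exact: (cg_hausdorff gr).
Qed.

End InvariantVertices.

Theorem equivariant_structure (x0 : X) : finite_graph R X ->
  exists (V E : finType) (v : V -> X) (c : E * bool -> R -> X) (rho : V -> V),
  [/\ cgraph v c, forall u, tau (v u) = v (rho u),
      forall e b t, tau (c (e, b) t) = c (e, ~~ b) t & exists u, x0 = v u].
Proof.
move=> [V0 [E0 [v0 [c0 gs]]]]; have tt := finv_involutive ft.
(* The base point is added before the images under [tau], so that its own image is added as well and
   the vertex set becomes invariant. *)
have [V1 [E1 [v1 [c1 [gr1 h1]]]]] := add_vertex (graph_structure_cgraph gs) x0.
have [V2 [E2 [v2 [c2 [gr2 h2]]]]] :=
  add_vertices [seq tau (v1 u) | u <- enum V1] gr1.
have range2 y : (exists u, y = v2 u) <-> (exists u, y = v1 u) \/ exists u, y = tau (v1 u).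
  split=> [/h2[|[i [si <-]]]|]; first by left.
    rewrite size_map in si; right.
    have [u _] : exists u : V1, True by case: (enum V1) si => // u; exists u.
    by exists (nth u (enum V1) i); rewrite (nth_map u).
  move=> h; apply/h2; case: h => [|[u ->]]; [by left|right].
  exists (index u (enum V1)); rewrite size_map index_mem mem_enum; split=> //.
  by rewrite (nth_map u) ?nth_index ?index_mem ?mem_enum.
have /choice[rho rhoP] : forall u, exists u', tau (v2 u) = v2 u'.
  move=> u; apply/range2; have /range2[[w ->]|[w ->]] : exists u', v2 u = v2 u' by exists u.
    by right; exists w.
  by left; exists w; rewrite tt.
have [E [c [gr cT]]] := invariant_vertices_structure gr2 rhoP.
exists V2, E, v2, c, rho; split=> //.
by apply/range2; left; apply/h1; right.
Qed.

End Involution.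

(** * Deforming the map *)

Section TokenPaths.
Variables (R : realType) (G : topologicalType) (S : finType) (adj : rel S).
Variables (coord : G -> S -> R) (mk : (S -> R) -> G).
Hypothesis sm : smodel adj coord mk.
Hypothesis Gc : connected [set: G].

Lemma path_to_vertex (x : G) (s : S) : exists d : R -> G,
  [/\ continuous d, d 0 = x & d 1 = vert mk s].
Proof.
have [a xa] := star_exists sm x; have hxa := star_simple sm xa.
have [p pp lp] := smodel_connected sm Gc a s.
have pe : path (estep adj) a p.
  by apply: sub_path pp => b d bd; rewrite /estep bd orbT.
exists (pcat (seg coord mk x (vert mk a)) (path_of coord mk a p)); split.
- apply: pcat_cts; [exact: (seg_cts sm)|exact: (path_of_cts sm)|].
  by rewrite (seg1 sm) // (path_of0 sm).
- by rewrite pcat0 (seg0 sm).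
- by rewrite pcat1 path_of1 lp.
Qed.

Lemma seg_avoids a a' b t : estep adj a a' -> b != a -> b != a' ->
  seg coord mk (vert mk a) (vert mk a') t <> vert mk b.
Proof.
move=> aa' ba ba' h.
have h1 : supp (coord (vert mk a)) a a' by exact: (supp_vert sm).
have h2 : supp (coord (vert mk a')) a a' by apply: supp_sym; exact: (supp_vert sm).
have := supp_seg sm t aa' h1 h2 ba ba'.
by rewrite h (coord_vert sm) eqxx => /eqP; rewrite oner_eq0.
Qed.

(** Both lists have the length of [m], so at every time both paths are in the same [tstep], where
    one of them is at rest off the edge of the other. *)
Lemma tokens_disjoint a b m t : a != b -> path (tstep adj) (a, b) m ->
  path_of coord mk a (map fst m) t <> path_of coord mk b (map snd m) t.
Proof.
elim: m a b t => [|[a' b'] m IHm] a b t ab /=.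
  move=> _ h; have := congr1 (fun z => coord z a) h.
  by rewrite !(coord_vert sm) eqxx eq_sym (negPf ab) => /eqP; rewrite oner_eq0.
move=> /andP[/and3P[/= _ a'b' h] pm]; rewrite /pcat; case: ifP => _; last exact: IHm.
case/orP: h => /andP[/eqP e st]; subst.
  rewrite (seg_same sm) => /esym; exact: seg_avoids.
rewrite (seg_same sm); apply: seg_avoids => //; by rewrite eq_sym.
Qed.

Variables (w n1 n2 n3 : S).
Hypotheses (wn1 : adj w n1) (wn2 : adj w n2) (wn3 : adj w n3).
Hypotheses (n12 : n1 != n2) (n13 : n1 != n3) (n23 : n2 != n3).

Theorem disjoint_paths (f1 f2 : R -> G) a b a' b' :
  continuous f1 -> continuous f2 -> a != b -> a' != b' ->
  f1 0 = vert mk a -> f1 1 = vert mk a' -> f2 0 = vert mk b -> f2 1 = vert mk b' ->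
  exists g1 g2, [/\ homot f1 g1, homot f2 g2 & forall t, g1 t <> g2 t].
Proof.
move=> cf1 cf2 ab ab' f10 f11 f20 f21.
have [P [pP lP hP]] := path_walk sm cf1 f10 f11.
have [Q [pQ lQ hQ]] := path_walk sm cf2 f20 f21.
have [|m [pm _ wP wQ]] := reach_walks (sm_sym sm) (sm_irr sm) wn1 wn2 wn3 n12 n13 n23
  (smodel_connected sm Gc) pP pQ ab; first by rewrite lP lQ.
exists (path_of coord mk a (map fst m)), (path_of coord mk b (map snd m)); split.
- have [sP _ _ h] := weq_homot sm a wP.
  apply: homot_trans hP _; apply: homot_sym; apply: h; by rewrite sP.
- have [sQ _ _ h] := weq_homot sm b wQ.
  apply: homot_trans hQ _; apply: homot_sym; apply: h; by rewrite sQ.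
- by move=> t; exact: tokens_disjoint.
Qed.

End TokenPaths.

(** In each orbit the vertex with the smaller key is coloured; [u0] has the least key of all. *)
Lemma equivariant_coloring (V : finType) (rho : V -> V) (u0 : V) :
  involutive rho -> (forall u, rho u != u) ->
  exists A : V -> bool, A u0 /\ forall u, A (rho u) = ~~ A u.
Proof.
move=> rr rne.
pose key u := if u == u0 then 0%N else (enum_rank u).+1.
exists (fun u => (key u < key (rho u))%N); split.
  by rewrite /key eqxx (negPf (rne u0)).
move=> u; rewrite rr -leqNgt ltn_neqAle.
suff -> : key (rho u) != key u by [].
apply/eqP; rewrite /key.
case: (eqVneq u u0) => [->|u1]; first by rewrite (negPf (rne u0)).
case: (eqVneq (rho u) u0) => // _ [h].
by have := rne u; rewrite (enum_rank_inj (ord_inj h)) eqxx.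
Qed.

Theorem theorem1p3 (R : realType) (Gamma G : ptopologicalType)
    (tau : Gamma -> Gamma)
    (Gamma_graph : finite_graph R Gamma)
    (Gamma_connected : connected [set: Gamma])
    (G_graph : finite_graph R G)
    (G_connected : connected [set: G])
    (tau_free_involution : free_involution tau)
    (G_not_point : [set: G] <> [set point])
    (G_not_circle : ~ homeomorphic G (circle R))
    (G_not_interval : ~ homeomorphic G (unit_interval R)) :
  forall alpha : set (Gamma -> G), homotopy_classes R Gamma G alpha ->
    ~ borsuk_ulam_property tau alpha /\
    exists2 f, alpha f & forall x, f x <> f (tau x).
Proof.
move=> alpha [f [cf fpt] alphaE].
suff [g [bg hg gne]] : exists g : Gamma -> G,
    [/\ based_map g, based_homotopic R f g & forall x, g x <> g (tau x)].
  have ag : alpha g by rewrite alphaE.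
  split; last by exists g.
  by move=> /(_ g ag)[x]; exact: gne.
have npt : ~ (forall x y : G, x = y).
  by move=> h; apply: G_not_point; apply/seteqP; split=> x //= _; exact: h.
have [S [adj [coord [mk [sm [w [n1 [n2 [n3 [[wn1 wn2 wn3] [n12 n13 n23]]]]]] [s0 s0pt]]]]]] :=
  graph_smodel point G_graph G_connected npt G_not_circle G_not_interval.
have [V [E [v [c [rho [gr tau_v tau_c [u0 u0pt]]]]]]] :=
  equivariant_structure tau_free_involution point Gamma_graph.
have tt := finv_involutive tau_free_involution.
have rr : involutive rho by move=> u; apply: (cg_inj gr); rewrite -!tau_v tt.
have rne u : rho u != u.
  apply/eqP => h; apply: (finv_free tau_free_involution (x := v u)).
  by rewrite tau_v h.
have [A [A0 Arho]] := equivariant_coloring u0 rr rne.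
have [s1 s01] : exists s1, s0 != s1.
  have [h|h] := eqVneq s0 w; last by exists w.
  by exists n1; rewrite h; exact: (adj_neq (sm_irr sm)).
(* Two target vertices suffice, since only [u] and [rho u] have to be separated. The base vertex
   goes to [s0], the base point of G. *)
pose psi u := if A u then s0 else s1.
have psi_ne u : psi u != psi (rho u).
  by rewrite /psi Arho; case: (A u); rewrite //= eq_sym.
(* [D u] drags the image of the vertex [u]. At the base vertex it is constant, which makes the final
   homotopy based. *)
have /choice[D DP] : forall u, exists d : R -> G, [/\ continuous d, d 0 = f (v u),
    d 1 = vert mk (psi u) & u = u0 -> forall t, d t = point].
  move=> u; have [->|ne] := eqVneq u u0.
    exists (fun=> point); split=> //; first exact: cst_continuous.
      by rewrite -u0pt fpt.
    by rewrite /psi A0 s0pt.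
  have [d [cd d0 d1]] := path_to_vertex sm G_connected (f (v u)) (psi u).
  by exists d; split=> // uu0; rewrite uu0 eqxx in ne.
have /choice[st stP] : forall eb : E * bool * bool, exists u,
    c eb.1 (bnd eb.2) = v u by move=> [e b]; exact: (cg_end gr).
have st_rho e b o : st (e, ~~ b, o) = rho (st (e, b, o)).
  by apply: (cg_inj gr); rewrite -tau_v -!stP /= tau_c.
pose loc e := f \o c e.
have cloc e : continuous (loc e) by exact: cts_comp cf (cg_cts gr e).
(* The image of the edge after dragging its ends: a path between vertices of S, as [disjoint_paths]
   requires. *)
pose lam e := pcat (path_inv (D (st (e, false)))) (pcat (loc e) (D (st (e, true)))).
have D0 u : D u 0 = f (v u) by have [] := DP u.
have D1 u : D u 1 = vert mk (psi u) by have [] := DP u.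
have cD u : continuous (D u) by have [] := DP u.
have loc0 e : loc e 0 = f (v (st (e, false))) by rewrite /loc /= -stP.
have loc1 e : loc e 1 = f (v (st (e, true))) by rewrite /loc /= -stP.
have clam e : continuous (lam e).
  apply: pcat_cts; [exact: path_inv_cts|apply: pcat_cts|] => //; first by rewrite loc1.
  by rewrite pcat0 /path_inv subrr D0 loc0.
have lam0 e : lam e 0 = vert mk (psi (st (e, false))).
  by rewrite /lam pcat0 /path_inv subr0 D1.
have lam1 e : lam e 1 = vert mk (psi (st (e, true))) by rewrite /lam !pcat1 D1.
have /choice[gg ggP] : forall e : E, exists gg : (R -> G) * (R -> G),
    [/\ homot (lam (e, false)) gg.1, homot (lam (e, true)) gg.2 &
        forall t, gg.1 t <> gg.2 t].
  move=> e.
  have [||g1 [g2 [h1 h2 ne]]] := disjoint_paths sm G_connected wn1 wn2 wn3 n12 n13 n23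
    (clam (e, false)) (clam (e, true)) _ _ (lam0 _) (lam1 _) (lam0 _) (lam1 _).
  - by rewrite (st_rho e false).
  - by rewrite (st_rho e false).
  - by exists (g1, g2).
pose ga (e : E * bool) := if e.2 then (gg e.1).2 else (gg e.1).1.
have hga e : homot (lam e) (ga e).
  by case: e => e []; have [h1 h2 _] := ggP e.
have ga_ne e b t : ga (e, b) t <> ga (e, ~~ b) t.
  have [_ _ ne] := ggP e; rewrite /ga; case: b => /=; last exact: ne.
  by move=> /esym; exact: ne.
have /choice[K KP] : forall e, exists H : R * R -> G, [/\ continuous H,
    forall t, 0 <= t <= 1 -> H (t, 0) = loc e t /\ H (t, 1) = ga e t &
    forall s, 0 <= s -> H (0, s) = D (st (e, false)) (Num.min (2 * s) 1) /\
                        H (1, s) = D (st (e, true)) (Num.min (2 * s) 1)].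
  by move=> e; apply: (square_fill _ _ _ _ _ (hga e)); rewrite ?D0 ?loc0 ?loc1.
(* The sides of the squares [K e] depend only on the vertex, so they fit together. Vertex images are
   dragged during the first half of the time and then rest. *)
have [|||H [cH Hv Hc]] := @cell_glue R Gamma V _ v c gr (unit_interval R) G
  (fun u p => D u (Num.min (2 * set_val p) 1)) (fun e t p => K e (t, set_val p))
  (@unit_compact R) (@unit_hausdorff R).
- move=> u; apply: (cts_comp (cD u)); apply: cts_min; last exact: cst_continuous.
  by apply: cts_mul; [exact: cst_continuous|exact: set_val_cts].
- move=> e; have [cK _ _] := KP e; apply: (cts_comp cK).
  by apply: cts_pair; [exact: cts_fst|exact: cts_comp (@set_val_cts R) (@cts_snd R _)].
- move=> e b u; rewrite (stP (e, b)) => /(cg_inj gr) <- p.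
  have [_ _ hK] := KP e; have /andP[p0 _] := unit_itv p; have [h0 h1] := hK _ p0.
  by case: b.
have i0 : set_val (clampI (0 : R)) = 0 by rewrite clampIE clamp0.
have i1 : set_val (clampI (1 : R)) = 1 by rewrite clampIE clamp1.
have oo_cc (t : R) : 0 < t < 1 -> 0 <= t <= 1 by move=> /andP[? ?]; rewrite !ltW.
pose g x := H (x, clampI 1).
have gv u : g (v u) = vert mk (psi u).
  by rewrite /g Hv i1 mulr1 min_r ?D1 // ler1n.
have gc e t : 0 < t < 1 -> g (c e t) = ga e t.
  by move=> t01; rewrite /g Hc ?oo_cc // i1; have [_ /(_ t (oo_cc _ t01))[]] := KP e.
have Hpt p : H (point, p) = point.
  by rewrite u0pt Hv; have [_ _ _ ->] := DP u0.
exists g; split.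
- split; last exact: Hpt.
  apply: (cts_comp cH (f := fun x => (x, clampI 1))).
  by apply: cts_pair; [exact: cts_id|exact: cst_continuous].
- exists H; split=> // x p px.
    have -> : p = clampI 0 by rewrite -(clampIK p) px.
    case: (cg_cover gr x) => [[u ->]|[e [t [t01 ->]]]].
      by rewrite Hv i0 mulr0 min_l ?ler01 // D0.
    by rewrite Hc ?oo_cc // i0; have [_ /(_ t (oo_cc _ t01))[]] := KP e.
  by rewrite -(clampIK p) px.
- have vne a b : a != b -> vert mk a <> vert mk b.
    move=> ab h; have := congr1 (fun z => coord z a) h.
    by rewrite !(coord_vert sm) eqxx eq_sym (negPf ab) => /eqP; rewrite oner_eq0.
  move=> x; case: (cg_cover gr x) => [[u ->]|[[e b] [t [t01 ->]]]].
    by rewrite tau_v !gv; apply: vne; exact: psi_ne.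
  by rewrite tau_c !gc //; exact: ga_ne.
Qed.
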